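(* Let $\mathbb{F}$ be an algebraically closed field, $G$ an abelian group and $m,n\ge 1$. Every even $G$-grading on the associative superalgebra $M(m,n)$ is isomorphic to some $\Gamma(T,\beta,\gamma_0,\gamma_1)$. Two even gradings, $\Gamma(T,\beta,\gamma_0,\gamma_1)$ and $\Gamma(T',\beta',\gamma_0',\gamma_1')$, on $M(m,n)$ are isomorphic if, and only if, $T=T'$, $\beta=\beta'$, and there is $g\in G$ such that (i) for $m\neq n$: $g\,\Xi(\gamma_0)=\Xi(\gamma_0')$ and $g\,\Xi(\gamma_1)=\Xi(\gamma_1')$; (ii) for $m=n$: either $g\,\Xi(\gamma_0)=\Xi(\gamma_0')$ and $g\,\Xi(\gamma_1)=\Xi(\gamma_1')$, or $g\,\Xi(\gamma_0)=\Xi(\gamma_1')$ and $g\,\Xi(\gamma_1)=\Xi(\gamma_0')$.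
   Context: $M(m,n)$ is the associative superalgebra $M_{m+n}(\mathbb{F})=\mathrm{End}(\mathbb{F}^m\oplus\mathbb{F}^n)$ whose even part consists of the block-diagonal matrices and whose odd part consists of the block-off-diagonal matrices (diagonal blocks of sizes $m$ and $n$). A $G$-grading on a superalgebra $A=A^{\bar 0}\oplus A^{\bar 1}$ is a decomposition $A=\bigoplus_{g\in G}A_g$ with $A_gA_h\subseteq A_{gh}$ and $A_g=(A_g\cap A^{\bar 0})\oplus(A_g\cap A^{\bar 1})$. Two $G$-gradings $A=\bigoplus A_g$ and $A=\bigoplus A'_g$ are isomorphic if some automorphism $\varphi$ of the superalgebra $A$ satisfies $\varphi(A_g)=A'_g$ for all $g$. Graded division algebras. A graded division algebra is a graded unital associative algebra in which every nonzero homogeneous element is invertible. If $D$ is a finite-dimensional $G$-graded division algebra that is simple as an algebra, then $T=\mathrm{supp}\,D$ is a finite subgroup of $G$, each $D_t$ ($t\in T$) is spanned by one element $X_t$, and $X_uX_v=\beta(u,v)X_vX_u$ defines a nondegenerate alternating bicharacter $\beta:T\times T\to\mathbb{F}^\times$ (alternating: $\beta(t,t)=1$; nondegenerate: $\beta(t,T)=1$ only for $t=e$). Up to graded isomorphism $D$ is determined by $(T,\beta)$, and every pair $(T,\beta)$ of a finite subgroup and a nondegenerate alternating bicharacter occurs; $\dim D=|T|$ and $D\cong M_{\sqrt{|T|}}(\mathbb{F})$ as an algebra. Even and odd gradings. Put $G^\#=G\times\mathbb{Z}_2$ and identify $G$ with $G\times\{\bar 0\}$. A $G$-grading on a superalgebra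 is the same as a $G^\#$-grading on the underlying algebra. For any $G$-grading on $M(m,n)$ there are a $G^\#$-graded division algebra $D$ and a $G^\#$-graded right $D$-module $\mathcal{U}$ of finite rank with $M(m,n)\cong\mathrm{End}_D(\mathcal{U})$ as $G^\#$-graded algebras. The grading is called even if $\mathrm{supp}\,D\subseteq G\times\{\bar 0\}$, and odd otherwise. The grading $\Gamma(T,\beta,\gamma_0,\gamma_1)$. Let $T\subseteq G$ be a finite subgroup, $\beta$ a nondegenerate alternating bicharacter on $T$, $D$ the graded division algebra associated to $(T,\beta)$ (realized as a matrix algebra, with trivial $\mathbb{Z}_2$-grading), and let $\gamma_0=(g_1,\dots,g_{k_0})$ and $\gamma_1=(g_{k_0+1},\dots,g_{k_0+k_1})$ be tuples of elements of $G$ with $k_0\sqrt{|T|}=m$, $k_1\sqrt{|T|}=n$. Identify $M(m,n)$ with $M_{k_0+k_1}(\mathbb{F})\otimes D$ via the Kronecker product (the first $k_0$ indices giving the first diagonal block). Then $\Gamma(T,\beta,\gamma_0,\gamma_1)$ is the $G$-grading on $M(m,n)$ given by $\deg(E_{ij}\otimes d)=g_i(\deg d)g_j^{-1}$ for homogeneous $d\in D$, where $E_{ij}$ are the matrix units. Multisets. For a tuple $\gamma=(g_1,\dots,g_k)$ in $G$, $\Xi(\gamma)$ is the multiset in $G/T$ consisting of the cosets $g_1T,\dots,g_kT$ counted with multiplicity; $G$ acts on such multisets by multiplication. *)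

(* Defs.v *)
From HB Require Import structures.
From mathcomp Require Import all_boot all_order all_algebra all_field.
From mathcomp Require Import finmap multiset mxtens.

Set Implicit Arguments.
Unset Strict Implicit.
Unset Printing Implicit Defensive.

Import GRing.Theory.
Local Open Scope fset_scope.
Local Open Scope ring_scope.

(* Abelian groups are written additively, as [zmodType]s. *)

Section Gradings.
Variables (F : fieldType) (H : zmodType).

(* V is the direct sum of the V_ h, for h ranging over the possibly infinite H *)
Definition decomposition (V : vectType F) (V_ : H -> {vspace V}) : Prop :=
  (forall s : seq H, uniq s -> directv (\sum_(h <- s) V_ h)) /\
  (forall v : V, exists s : seq H, v \in (\sum_(h <- s) V_ h)%VS).

(* The product is a parameter because 'M_n has no canonical falgType structure
   for arbitrary n. *)
Definition grading (A : vectType F) (mul : A -> A -> A)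
    (A_ : H -> {vspace A}) : Prop :=
  decomposition A_ /\
  (forall g h x y, x \in A_ g -> y \in A_ h -> mul x y \in A_ (g + h)).

Definition division_grading (A : vectType F) (mul : A -> A -> A) (one : A)
    (A_ : H -> {vspace A}) : Prop :=
  grading mul A_ /\
  (forall h x, x \in A_ h -> x != 0 ->
     exists y, mul x y = one /\ mul y x = one).

Definition supported_in (V : vectType F) (V_ : H -> {vspace V})
    (S : pred H) : Prop :=
  forall h, V_ h != 0%VS -> S h.

(* act u d is the right action u d, and U_ a grading of the D-module U *)
Record graded_right_module (D : falgType F) (D_ : H -> {vspace D})
    (U : vectType F) (act : U -> D -> U) (U_ : H -> {vspace U}) : Prop := {
  ract_linear_l : forall d, linear (act^~ d);
  ract_linear_r : forall u, linear (act u);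
  ract1 : forall u, act u 1 = u;
  ractM : forall u d e, act u (d * e) = act (act u d) e;
  ract_decomposition : decomposition U_;
  ract_degree : forall g h u d, u \in U_ g -> d \in D_ h -> act u d \in U_ (g + h)
}.

(* U has a finite D-basis consisting of homogeneous elements *)
Definition finite_rank (D : falgType F) (U : vectType F) (act : U -> D -> U)
    (U_ : H -> {vspace U}) : Prop :=
  exists k (b : 'I_k -> U), (forall i, exists h, b i \in U_ h) /\
    (forall u, exists! d : {ffun 'I_k -> D}, u = \sum_i act (b i) (d i)).

Definition endomorphism_over (D : falgType F) (U : vectType F)
    (act : U -> D -> U) (f : 'End(U)) : Prop :=
  forall u d, f (act u d) = act (f u) d.

Definition homogeneous_map (U : vectType F) (U_ : H -> {vspace U}) (g : H)
    (f : 'End(U)) : Prop :=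
  forall h u, u \in U_ h -> f u \in U_ (g + h).

(* The algebra 'M_N with the H-grading A_ is isomorphic, as a graded algebra,
   to End_D(U). *)
Definition iso_to_End (N : nat) (A_ : H -> {vspace 'M[F]_N})
    (D : falgType F) (U : vectType F) (act : U -> D -> U)
    (U_ : H -> {vspace U}) : Prop :=
  exists Phi : 'Hom('M[F]_N, 'End(U)),
    [/\ injective Phi,
        Phi 1%:M = \1%VF,
        forall x y, Phi (x *m y) = (Phi x \o Phi y)%VF,
        forall f, endomorphism_over act f <-> exists x, f = Phi x
      & forall g f, (endomorphism_over act f /\ homogeneous_map U_ g f) <->
                    exists2 x, x \in A_ g & f = Phi x].

End Gradings.

Section Superalgebra.
Variables (F : fieldType) (m n : nat).

Definition diag_part : {vspace 'M[F]_(m + n)} :=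
  (linfun (fun x : 'M[F]_m * 'M[F]_n => block_mx x.1 0 0 x.2) @: fullv)%VS.

Definition offdiag_part : {vspace 'M[F]_(m + n)} :=
  (linfun (fun x : 'M[F]_(m, n) * 'M[F]_(n, m) => block_mx 0 x.1 x.2 0)
     @: fullv)%VS.

Definition super_part (p : 'Z_2) : {vspace 'M[F]_(m + n)} :=
  if p == 0 then diag_part else offdiag_part.

Definition super_automorphism (phi : 'End('M[F]_(m + n))) : Prop :=
  [/\ bijective phi,
      phi 1%:M = 1%:M,
      forall x y, phi (x *m y) = phi x *m phi y
    & forall p, (phi @: super_part p)%VS = super_part p].

Variable G : zmodType.

Definition super_grading (A_ : G -> {vspace 'M[F]_(m + n)}) : Prop :=
  grading (@mulmx F _ _ _) A_ /\
  (forall g, A_ g = (A_ g :&: super_part 0%R + A_ g :&: super_part 1%R)%VS).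

Definition grading_iso (A_ B_ : G -> {vspace 'M[F]_(m + n)}) : Prop :=
  exists phi, super_automorphism phi /\ forall g, (phi @: A_ g)%VS = B_ g.

(* the grading by G x Z_2 of the underlying algebra *)
Definition sharp (A_ : G -> {vspace 'M[F]_(m + n)}) :
    (G * 'Z_2)%type -> {vspace 'M[F]_(m + n)} :=
  fun gp => (A_ gp.1 :&: super_part gp.2)%VS.

Definition even_grading (A_ : G -> {vspace 'M[F]_(m + n)}) : Prop :=
  super_grading A_ /\
  exists (D : falgType F) (D_ : (G * 'Z_2)%type -> {vspace D})
         (U : vectType F) (act : U -> D -> U)
         (U_ : (G * 'Z_2)%type -> {vspace U}),
    [/\ division_grading *%R 1 D_,
        graded_right_module D_ act U_,
        finite_rank act U_,
        iso_to_End (sharp A_) act U_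
      & supported_in D_ (fun gp => gp.2 == 0)].

End Superalgebra.

Section Gamma.
Variables (F : fieldType) (G : zmodType).

Definition subgroup (T : {fset G}) : Prop :=
  0 \in T /\ {in T &, forall u v, u - v \in T}.

(* Only the restriction of beta to T x T is relevant. *)
Record nondeg_alt_bicharacter (T : {fset G}) (beta : G -> G -> F) : Prop := {
  bichar_neq0 : {in T &, forall u v, beta u v != 0};
  bicharDl : {in T & &, forall u v w, beta (u + v) w = beta u w * beta v w};
  bicharDr : {in T & &, forall u v w, beta u (v + w) = beta u v * beta u w};
  bichar_alt : {in T, forall t, beta t t = 1};
  bichar_nondeg : {in T, forall t, {in T, forall u, beta t u = 1} -> t = 0}
}.

(* D_ makes 'M_l a graded division algebra associated with (T, beta) *)
Definition realizes (T : {fset G}) (beta : G -> G -> F)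
    (l : nat) (D_ : G -> {vspace 'M[F]_l}) : Prop :=
  [/\ (l ^ 2 = #|` T|)%N,
      division_grading (@mulmx F _ _ _) 1%:M D_,
      forall t, (t \in T) = (D_ t != 0%VS)
    & {in T &, forall u v x y, x \in D_ u -> y \in D_ v ->
        x *m y = beta u v *: (y *m x)}].

(* (T, beta) together with a realization D_ of its graded division algebra *)
Definition division_data (T : {fset G}) (beta : G -> G -> F)
    (l : nat) (D_ : G -> {vspace 'M[F]_l}) : Prop :=
  [/\ subgroup T, nondeg_alt_bicharacter T beta & realizes T beta D_].

Lemma kron_dim (k0 k1 l m n : nat) :
  (k0 * l = m)%N -> (k1 * l = n)%N -> ((k0 + k1) * l = m + n)%N.
Proof. by move=> <- <-; rewrite mulnDl. Qed.

Section Def.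
Variables (m n l : nat) (gamma0 gamma1 : seq G).
Hypotheses (e0 : (size gamma0 * l = m)%N) (e1 : (size gamma1 * l = n)%N).

(* E_ij (x) d, as an (m + n) x (m + n) matrix *)
Definition kron (i j : 'I_(size gamma0 + size gamma1)) (d : 'M[F]_l) :
    'M[F]_(m + n) :=
  castmx (kron_dim e0 e1, kron_dim e0 e1) (delta_mx i j *t d).

Definition Gamma (T : {fset G}) (D_ : G -> {vspace 'M[F]_l}) (g : G) :
    {vspace 'M[F]_(m + n)} :=
  let gamma := gamma0 ++ gamma1 in
  (\sum_(i < size gamma0 + size gamma1) \sum_(j < size gamma0 + size gamma1)
     \sum_(t <- T | (gamma`_i + t - gamma`_j == g)%R)
       linfun (kron i j) @: D_ t)%VS.

End Def.

(* Cosets g T are finite sets, so multisets in G / T are multisets of them. *)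
Definition translate (g : G) (C : {fset G}) : {fset G} := [fset g + x | x in C].

Definition Xi (T : {fset G}) (gamma : seq G) : {mset {fset G}}%mset :=
  seq_mset [seq translate g T | g <- gamma].

Definition act_mset (g : G) (X : {mset {fset G}}%mset) : {mset {fset G}}%mset :=
  seq_mset [seq translate g C | C <- X].

End Gamma.

(* Main.v *)
(* Both directions go through systems of matrix units over [D = 'M_l]: maps
   [K i j : 'M_l -> 'M_N] with [K i j d * K j p d' = K i p (d d')] and
   [\sum_i K i i 1 = 1].  Any such system whose degrees match those of
   [E_ij (x) d] yields an isomorphism from the corresponding [Gamma].

   Existence: a homogeneous D-basis of U gives matrix units of End_D(U) = 'M_N
   over D; the corner [K i i D] is [q 'M_N q] for an idempotent [q] of rank [l],
   whence [D = 'M_l], and the even idempotent [\sum K i i 1], over the [i] of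
   even degree, has to be one of the two block identities.

   Equivalent data give isomorphic gradings: two realizations of [(T, beta)] are
   conjugate, an intertwiner being a common eigenvector of commuting operators.

   Isomorphic gradings have equivalent data: the image under the isomorphism of
   a diagonal idempotent [E_ii (x) 1] is linked by elements [x], [y] of degree 0
   to some [E_jj (x) 1], because the corners of both are graded division
   algebras and 'M_N is simple.  This carries [D] to [D'] and, comparing
   dimensions of the homogeneous components of the columns, [Xi] to [Xi']. *)

Require Import Defs.
From HB Require Import structures.
From mathcomp Require Import all_boot all_order all_algebra all_field.
From mathcomp Require Import finmap multiset mxtens.

Set Implicit Arguments.
Unset Strict Implicit.
Unset Printing Implicit Defensive.

Import GRing.Theory.
Local Open Scope fset_scope.
Local Open Scope ring_scope.

(** The superalgebra structure is carried by one element, the idempotent [p = parity_mx]: even means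
    commuting with [p], odd means [p x + x p = x]. For [m, n > 0] the only idempotents with these
    two properties are [p] and [1 - p]. This ambiguity is where the swapped alternative for [m = n]
    comes from; for [m <> n] the lengths of the tuples rule it out. It also explains why the
    parities of a homogeneous basis are matched with the two blocks only up to exchange. The
    equations involve no division by 2, so characteristic 2 is not a separate case. Infinitely many
    degrees are handled through linear projections onto the components, almost all of them zero;
    homogeneity then becomes an equation that can be pushed through products and isomorphisms. In
    the existence part nothing says in advance that the number of basis vectors of a given parity,
    times [l], is the size of a block. Ranks bound the blocks from above, and injectivity of the map
    on matrix units bounds the total number of basis vectors, so both bounds are equalities. *)

Lemma linfun_linear (F : fieldType) (U V : vectType F) (f : U -> V) :
  linear f -> linfun f =1 f.
Proof.
move=> lf; pose L := GRing.isLinear.Build F U V _ f lf.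
pose f' : {linear U -> V} := HB.pack f L.
exact: (lfunE f').
Qed.

(** * Decompositions into homogeneous components *)

Section Decomposition.
Variables (F : fieldType) (H : zmodType) (V : vectType F) (V_ : H -> {vspace V}).

Lemma subv_sum_seq (s : seq H) h : h \in s -> (V_ h <= \sum_(k <- s) V_ k)%VS.
Proof. by move=> hs; rewrite (big_rem h hs) /= addvSl. Qed.

Lemma sum_seq_subv (s : seq H) (W : {vspace V}) :
  {in s, forall h, (V_ h <= W)%VS} -> (\sum_(h <- s) V_ h <= W)%VS.
Proof.
move=> sW; rewrite big_seq; elim/big_ind: _ => //; first exact: sub0v.
by move=> A B AW BW; rewrite subv_add AW.
Qed.

(** Directness is an equality of dimensions. Since the dimension of a sum never exceeds the sum of
    dimensions, that equality forces [V_ a] to meet the sum of the other components in 0 and passes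
    to the tail. *)
Lemma direct_sum0 (s : seq H) (f : H -> V) :
    uniq s -> directv (\sum_(h <- s) V_ h) -> (forall h, f h \in V_ h) ->
  \sum_(h <- s) f h = 0 -> {in s, forall h, f h = 0}.
Proof.
move=> + /directvP/=; elim: s => [|a s IHs] //= /andP[a_s us].
rewrite !big_cons => dimE fV sum0.
have leW : (\dim (\sum_(h <- s) V_ h) <= \sum_(h <- s) \dim (V_ h))%N.
  exact: (dimv_leq_sum s xpredT V_).
have leD := dimv_sum_cap (V_ a) (\sum_(h <- s) V_ h)%VS.
move: leD; rewrite dimE -addnA => /eqP; rewrite eqn_add2l => /eqP dimD.
have dimW : \dim (\sum_(h <- s) V_ h) = (\sum_(h <- s) \dim (V_ h))%N.
  by apply/eqP; rewrite eqn_leq leW -dimD leq_addr.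
have cap0 : (V_ a :&: (\sum_(h <- s) V_ h) = 0)%VS.
  apply/eqP; rewrite -dimv_eq0 -(eqn_add2l (\dim (\sum_(h <- s) V_ h))) addn0.
  by rewrite {1}dimW dimD.
have fa0 : f a = 0.
  apply/eqP; rewrite -memv0 -cap0 memv_cap fV /=.
  move/eqP: sum0; rewrite addr_eq0 => /eqP ->; rewrite memvN.
  rewrite big_seq; apply: memv_suml => h hs.
  exact: (subvP (subv_sum_seq hs)).
move: sum0; rewrite fa0 add0r => sum0 h; rewrite inE => /orP[/eqP->//|].
exact: IHs.
Qed.

(** Working form of a decomposition: one projection for every degree of [H], with a finite list [s]
    that contains all degrees of nonzero components. *)
Record projections (s : seq H) (pr : H -> 'End(V)) : Prop := {
  projD : forall g v, pr g v \in V_ g;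
  projE : forall g h v, v \in V_ h -> pr g v = if g == h then v else 0;
  proj_sum : forall v, v = \sum_(h <- s) pr h v }.

Lemma decomposition_proj : decomposition V_ -> exists s pr, projections s pr.
Proof.
move=> [dirV covV].
have [s us sf] : exists2 s, uniq s & fullv = (\sum_(h <- s) V_ h)%VS.
  (* Finite dimension makes the list finite: each vector of a basis lies in a finite sum, and these
     lists are concatenated. *)
  have [s Xs] : exists s, forall v,
      v \in (vbasis {:V} : seq V) -> v \in (\sum_(h <- s) V_ h)%VS.
    elim: (vbasis fullv : seq V) => [|v X [s IH]]; first by exists [::].
    have [s' vs'] := covV v; exists (s' ++ s) => w.
    rewrite in_cons big_cat /= => /predU1P[->|/IH ws].
      by rewrite (subvP (addvSl _ _)).
    by rewrite (subvP (addvSr _ _)).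
  exists (undup s); first exact: undup_uniq.
  apply/esym/eqP; rewrite eqEsubv subvf /=.
  rewrite -{1}(span_basis (vbasisP fullv)).
  apply/span_subvP => v /Xs; apply: subvP; apply: sum_seq_subv => h hs.
  by apply: subv_sum_seq; rewrite mem_undup.
pose pr g := if g \in s then sumv_pi_for sf g else 0.
have prV g v : pr g v \in V_ g.
  by rewrite /pr; case: ifP => _; [apply: memv_sum_pi | rewrite zero_lfunE mem0v].
have prE v : v = \sum_(h <- s) pr h v.
  transitivity (\sum_(h <- s) sumv_pi_for sf h v).
    by rewrite sumv_pi_uniq_sum ?memvf // filter_predT.
  by rewrite big_seq [RHS]big_seq; apply: eq_bigr => h hs; rewrite /pr hs.
exists s, pr; split=> // g h v vh.
pose f k := pr k v - (if k == h then v else 0).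
have fV k : f k \in V_ k.
  by rewrite memvB //; case: eqP => [->|] //; rewrite mem0v.
(* The degree [h] may lie outside [s], where [pr h] is 0 by definition; directness over [h :: s]
   then gives [v = 0], so this value is correct. *)
set s' := undup (h :: s).
have us' : uniq s' := undup_uniq _.
have prs' : \sum_(k <- s') pr k v = v.
  rewrite /s' /= undup_id //; case: ifP => hs; first by rewrite -prE.
  by rewrite big_cons {1}/pr hs zero_lfunE add0r -prE.
have sum0 : \sum_(k <- s') f k = 0.
  rewrite sumrB prs' (big_rem h) /=; last by rewrite mem_undup mem_head.
  rewrite eqxx big_seq big1 ?addr0 ?subrr // => k.
  by rewrite mem_rem_uniq // inE => /andP[/negPf->].
have dir := direct_sum0 us' (dirV _ us') fV sum0.
have [gs'|gs'] := boolP (g \in s').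
  by have /eqP := dir g gs'; rewrite subr_eq0 => /eqP.
move: gs'; rewrite mem_undup inE negb_or => /andP[/negPf-> /negPf gs].
by rewrite /pr gs zero_lfunE.
Qed.

Lemma proj_inj s pr v w : projections s pr ->
  (forall g, pr g v = pr g w) -> v = w.
Proof.
move=> P vw; rewrite [v](proj_sum P) [w](proj_sum P).
by apply: eq_bigr => h _; apply: vw.
Qed.

Lemma proj_supp s pr h v : projections s pr -> h \notin s -> pr h v = 0.
Proof.
move=> P hs; rewrite [v](proj_sum P) linear_sum big_seq big1 // => k ks /=.
by rewrite (projE P _ (projD P k v)); case: eqP => // hk; rewrite hk ks in hs.
Qed.

Lemma proj_sum_supp s pr r v : projections s pr -> uniq r ->
  (forall h, h \notin r -> pr h v = 0) -> v = \sum_(h <- r) pr h v.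
Proof.
move=> P ur vr; apply: (proj_inj P) => g; rewrite linear_sum /=.
under eq_bigr do rewrite (projE P _ (projD P _ v)).
have [gr|gr] := boolP (g \in r).
  rewrite (big_rem g) //= eqxx big_seq big1 ?addr0 // => h.
  by rewrite mem_rem_uniq // !inE eq_sym => /andP[/negPf->].
rewrite vr // big_seq big1 // => h hr.
by case: eqP => // gh; rewrite gh hr in gr.
Qed.

(** A vector of [V_ a] that also lies in the sum of the other components is both fixed and killed by
    [pr a]. *)
Lemma proj_decomposition s pr : projections s pr -> decomposition V_.
Proof.
case=> prV prE prs; split; last first.
  move=> v; exists s; rewrite [v]prs big_seq; apply: memv_suml => h hs.
  exact: (subvP (subv_sum_seq hs)).
move=> r; move=> ur; apply/directvP => /=; elim: r ur => [|a r IHr] /=.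
  by rewrite !big_nil dimv0.
move=> /andP[ar ur]; rewrite !big_cons -(IHr ur) dimv_disjoint_sum //.
apply/eqP; rewrite -subv0; apply/subvP => v /memv_capP[va vr].
rewrite memv0; have := prE a a v va; rewrite eqxx => <-.
rewrite -memv_ker; move: vr; apply: subvP; apply: sum_seq_subv => h hr.
apply/subvP => w wh; rewrite memv_ker (prE _ h) //.
by case: (a =P h) => [ah|_]; [rewrite ah hr in ar | rewrite eqxx].
Qed.

End Decomposition.

Section ProjectionMul.
Variables (F : fieldType) (H : zmodType) (N : nat) (A_ : H -> {vspace 'M[F]_N}).
Variables (s : seq H) (pr : H -> 'End('M[F]_N)).
Hypotheses (mulA : forall g h x y, x \in A_ g -> y \in A_ h -> x *m y \in A_ (g + h))
  (P : projections A_ s pr).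

Lemma proj_mull t g x y : x \in A_ t -> pr (t + g) (x *m y) = x *m pr g y.
Proof.
move=> xt; rewrite [in LHS](proj_sum P y) [in RHS](proj_sum P y) mulmx_sumr.
rewrite !linear_sum /=; apply: eq_bigr => h _.
have yh := projD P h y.
rewrite (projE P _ (mulA xt yh)) (projE P _ yh) (inj_eq (addrI t)).
by case: ifP => _; rewrite ?mulmx0.
Qed.

Lemma proj_mulr t g x y : y \in A_ t -> pr (g + t) (x *m y) = pr g x *m y.
Proof.
move=> yt; rewrite [in LHS](proj_sum P x) [in RHS](proj_sum P x) mulmx_suml.
rewrite !linear_sum mulmx_suml /=; apply: eq_bigr => h _.
have xh := projD P h x.
rewrite (projE P _ (mulA xh yt)) (projE P _ xh) (inj_eq (addIr t)).
by case: ifP => _; rewrite ?mul0mx.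
Qed.

End ProjectionMul.


(** * Primeness, simplicity and centre of matrix algebras *)

Section MatrixAlgebra.
Variable F : fieldType.

(** Take the matrix unit that joins the column of a nonzero entry of [a] to the row of a nonzero
    entry of [b]. *)
Lemma mx_prime (N : nat) (a b : 'M[F]_N) : a != 0 -> b != 0 ->
  exists r, a *m r *m b != 0.
Proof.
move=> /matrix0Pn[i [j aij]] /matrix0Pn[k [l bkl]].
exists (delta_mx j k); apply/matrix0Pn; exists i, l.
rewrite mxE (bigD1 k) //= big1 => [|h hk]; last first.
  rewrite mxE big1 ?mul0r // => g _.
  by rewrite !mxE (negPf hk) andbF mulr0.
rewrite addr0 mxE (bigD1 j) //= big1 => [|h hj]; last first.
  by rewrite !mxE (negPf hj) mulr0.
by rewrite addr0 mxE !eqxx mulr1 mulf_neq0.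
Qed.

(** Simplicity: one nonzero entry of a kernel element brings every matrix unit, hence 1, into the
    kernel. *)
Lemma mx_unital_inj (p q : nat) (f : 'Hom('M[F]_p, 'M[F]_q)) : (0 < q)%N ->
    f 1%:M = 1%:M -> (forall x y, f (x *m y) = f x *m f y) ->
  injective f.
Proof.
move=> q_gt0 f1 fM; apply: raddf_inj => x fx0; apply/eqP; apply/negPn/negP.
move=> /matrix0Pn[i [j xij]].
have fdelta k l : f (delta_mx k l) = 0.
  have -> : delta_mx k l = (x i j)^-1 *: (delta_mx k i *m x *m delta_mx j l).
    apply/matrixP => a b; rewrite !mxE (bigD1 j) //= big1 => [|h hj]; last first.
      by rewrite !mxE (negPf hj) mulr0.
    rewrite addr0 mxE (bigD1 i) //= big1 => [|h hi]; last first.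
      by rewrite !mxE (negPf hi) andbF mul0r.
    rewrite addr0 !mxE !eqxx /= andbT.
    by case: (a == k); case: (b == l);
      rewrite ?mul1r ?mul0r ?mulr1 ?mulr0 ?mulVf.
  by rewrite linearZ /= !fM fx0 mulmx0 mul0mx scaler0.
have f10 : f 1%:M = 0.
  by rewrite mx1_sum_delta linear_sum big1 // => k _; apply: fdelta.
have /matrixP/(_ (Ordinal q_gt0) (Ordinal q_gt0))/eqP := f1.
by rewrite f10 !mxE eqxx eq_sym oner_eq0.
Qed.

Lemma mx_comm_scalar (p : nat) (a : 'M[F]_p) :
  (forall x, a *m x = x *m a) -> exists c, a = c%:M.
Proof.
case: p a => [|p] a ca; first by exists 0; apply/matrixP => -[].
exists (a 0 0); apply/matrixP => i j; rewrite mxE.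
have /matrixP/(_ i 0) := ca (delta_mx j 0).
rewrite mxE (bigD1 j) //= big1 => [|h hj]; last by rewrite mxE (negPf hj) mulr0.
rewrite addr0 !mxE !eqxx mulr1 => ->.
rewrite (bigD1 0) //= big1 => [|h hj]; last by rewrite mxE (negPf hj) andbF mul0r.
by rewrite addr0 mxE eqxx andbT; case: eqP => _; rewrite ?mul1r ?mul0r.
Qed.

End MatrixAlgebra.

(** * The block idempotent of M(m, n) *)

Section Parity.
Variables (F : fieldType) (m n : nat).

(** The projection onto the first summand. It turns membership in the even and odd parts into
    equations that algebra maps preserve. *)
Definition parity_mx : 'M[F]_(m + n) := block_mx 1%:M 0 0 0.

Lemma mem_diag_part x :
  (x \in diag_part F m n) = (parity_mx *m x == x *m parity_mx).
Proof.
have lf : linear (fun x : 'M[F]_m * 'M[F]_n =>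
    block_mx x.1 0 0 x.2 : 'M_(m + n)).
  by move=> c a b; rewrite scale_block_mx add_block_mx !scaler0 !addr0.
apply/memv_imgP/eqP => [[u _ ->]|].
  by rewrite linfun_linear // !mulmx_block !(mulmx0, mul0mx, mulmx1, mul1mx, addr0).
rewrite -{1 2}[x]submxK !mulmx_block !(mulmx0, mul0mx, mulmx1, mul1mx, addr0).
case/eq_block_mx => _ b0 c0 _; exists (ulsubmx x, drsubmx x); first exact: memvf.
by rewrite linfun_linear //= -{1}[x]submxK b0 -c0.
Qed.

Lemma mem_offdiag_part x :
  (x \in offdiag_part F m n) = (parity_mx *m x + x *m parity_mx == x).
Proof.
have lf : linear (fun x : 'M[F]_(m, n) * 'M[F]_(n, m) =>
    block_mx 0 x.1 x.2 0 : 'M_(m + n)).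
  by move=> c a b; rewrite scale_block_mx add_block_mx !scaler0 !addr0.
apply/memv_imgP/eqP => [[u _ ->]|].
  rewrite linfun_linear // !mulmx_block !(mulmx0, mul0mx, mulmx1, mul1mx, addr0).
  by rewrite add_block_mx !add0r !addr0.
rewrite -{1 2 3}[x]submxK !mulmx_block !(mulmx0, mul0mx, mulmx1, mul1mx, addr0).
rewrite add_block_mx !add0r !addr0.
case/eq_block_mx => a0 _ _ d0; exists (ursubmx x, dlsubmx x); first exact: memvf.
rewrite linfun_linear //= -{1}[x]submxK -d0; congr block_mx.
by move/(congr1 (+%R (- ulsubmx x))): a0; rewrite addrA addNr add0r.
Qed.

(** Commuting with the even part makes [p] block diagonal with scalar blocks [al] and [de]; the odd
    equation gives [al + de = 1], and idempotence makes [al] 0 or 1. *)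
Lemma parity_idempotent p : (0 < m)%N -> (0 < n)%N -> p *m p = p ->
    {in diag_part F m n, forall x, p *m x = x *m p} ->
    {in offdiag_part F m n, forall x, p *m x + x *m p = x} ->
  p = parity_mx \/ p = 1%:M - parity_mx.
Proof.
move=> m_gt0 n_gt0 pp pdiag poff.
have [a [d pE]] : exists a d, p = block_mx a 0 0 d.
  have := pdiag parity_mx; rewrite mem_diag_part eqxx => /(_ isT).
  rewrite -{1 2}[p]submxK !mulmx_block !(mulmx0, mul0mx, mulmx1, mul1mx, addr0).
  case/eq_block_mx => _ b0 c0 _; exists (ulsubmx p), (drsubmx p).
  by rewrite -{1}[p]submxK b0 -c0.
have aa : a *m a = a.
  move: pp; rewrite pE !mulmx_block !(mulmx0, mul0mx, addr0, add0r).
  by case/eq_block_mx.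
have ad x y : a *m x = x *m a /\ d *m y = y *m d.
  have := pdiag (block_mx x 0 0 y); rewrite mem_diag_part pE.
  rewrite !mulmx_block !(mulmx0, mul0mx, mulmx1, mul1mx, addr0, add0r) eqxx.
  by case/(_ isT)/eq_block_mx.
have [al aE] : exists al, a = al%:M by apply: mx_comm_scalar => x; case: (ad x 0).
have [de dE] : exists de, d = de%:M by apply: mx_comm_scalar => y; case: (ad 0 y).
have := poff (block_mx 0 (const_mx 1) 0 0); rewrite mem_offdiag_part pE.
rewrite !mulmx_block !(mulmx0, mul0mx, mulmx1, mul1mx, addr0, add0r).
rewrite !add_block_mx !(addr0, add0r) eqxx => /(_ isT)/eq_block_mx[_ + _ _].
pose i0 := Ordinal m_gt0; pose j0 := Ordinal n_gt0.
move=> /matrixP/(_ i0 j0); rewrite aE dE mul_scalar_mx mul_mx_scalar !mxE !mulr1.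
move=> ald; have := aa; rewrite aE -scalar_mxM => /matrixP/(_ i0 i0).
rewrite !mxE !eqxx !mulr1n => /eqP; rewrite -subr_eq0 -{3}[al]mulr1 -mulrBr mulf_eq0.
have -> : 1%:M - parity_mx = block_mx 0 0 0 1%:M.
  by rewrite scalar_mx_block opp_block_mx add_block_mx !subr0 subrr.
case/orP => [/eqP al0|]; [right|rewrite subr_eq0 => /eqP al1; left].
  by move: ald; rewrite al0 add0r => ->; rewrite raddf0.
by move: ald; rewrite al1 -{2}[1]addr0 => /addrI ->; rewrite raddf0.
Qed.

(** Both equations that describe the parts are invariant under [p -> 1 - p], so either value of
    [phi parity_mx] sends each part into itself; injectivity and dimension give equality. *)
Lemma parity_super_automorphism (phi : 'End('M[F]_(m + n))) :
    injective phi -> phi 1%:M = 1%:M ->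
    (forall x y, phi (x *m y) = phi x *m phi y) ->
    phi parity_mx = parity_mx \/ phi parity_mx = 1%:M - parity_mx ->
  super_automorphism phi.
Proof.
move=> phi_inj phi1 phiM phip.
have ker0 : lker phi == 0%VS by apply/lker0P.
split=> //; first exact: Bijective (lker0_lfunK ker0) (lker0_lfunVK ker0).
move=> p; apply/eqP.
rewrite eqEdim limg_dim_eq ?leqnn ?andbT; last by rewrite (eqP ker0) capv0.
apply/subvP => _ /memv_imgP[x + ->]; rewrite /super_part; case: ifP => _.
  rewrite !mem_diag_part => /eqP/(congr1 phi); rewrite !phiM.
  case: phip => -> => [/eqP//|].
  by rewrite mulmxBl mulmxBr mul1mx mulmx1 => /addrI/oppr_inj/eqP.
rewrite !mem_offdiag_part => /eqP/(congr1 phi); rewrite linearD /= !phiM.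
case: phip => -> => [/eqP//|].
rewrite mulmxBl mulmxBr mul1mx mulmx1 => /eqP.
by rewrite addrACA -opprD subr_eq (inj_eq (addrI _)) eq_sym.
Qed.

Lemma super_automorphism_parity (phi : 'End('M[F]_(m + n))) :
    (0 < m)%N -> (0 < n)%N -> super_automorphism phi ->
  phi parity_mx = parity_mx \/ phi parity_mx = 1%:M - parity_mx.
Proof.
move=> m_gt0 n_gt0 [_ _ phiM phiS]; apply: parity_idempotent => //.
- by rewrite -phiM mulmx_block !(mulmx0, mul0mx, mulmx1, mul1mx, addr0).
- move=> x; have := phiS 0; rewrite /super_part eqxx => <- /memv_imgP[y + ->].
  by rewrite mem_diag_part -!phiM => /eqP->.
- move=> x; have := phiS 1; rewrite /super_part /= => <- /memv_imgP[y + ->].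
  by rewrite mem_offdiag_part -!phiM -linearD => /eqP->.
Qed.

Lemma grading_iso_sym (G : zmodType) (A_ B_ : G -> {vspace 'M[F]_(m + n)}) :
  grading_iso A_ B_ -> grading_iso B_ A_.
Proof.
move=> [phi [[phi_bij phi1 phiM phiS] phiA]].
have ker0 : lker phi == 0%VS by apply/lker0P; apply: bij_inj.
have fK := lker0_lfunK ker0; have fVK := lker0_lfunVK ker0.
have imK U : ((phi^-1)%VF @: (phi @: U))%VS = U.
  by rewrite -limg_comp lker0_compVf // lim1g.
exists phi^-1%VF; split=> [|g]; last by rewrite -phiA imK.
split=> [|||p]; first exact: Bijective fVK fK.
- by rewrite -phi1 fK.
- by move=> x y; rewrite -{1}[x]fVK -{1}[y]fVK -phiM fK.
- by rewrite -{1}phiS imK.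
Qed.

End Parity.

(** * Matrix units *)

Section TensorBlocks.
Variables (F : fieldType) (k l N : nat) (e : (k * l = N)%N).

(** [kron] is the case [k = size gamma0 + size gamma1]; an arbitrary number of indices keeps the two
    tuples out of the calculus of matrix units. *)
Definition tunit (i j : 'I_k) (d : 'M[F]_l) : 'M[F]_N :=
  castmx (e, e) (delta_mx i j *t d).

Definition tblock (i j : 'I_k) (x : 'M[F]_N) : 'M[F]_l :=
  \matrix_(a, b) x (cast_ord e (mxtens_index (i, a)))
                   (cast_ord e (mxtens_index (j, b))).

Lemma tunit_linear i j : linear (tunit i j).
Proof.
move=> c x y; apply/matrixP => a b; rewrite !(castmxE, mxE).
by rewrite mulrDr mulrCA.
Qed.
HB.instance Definition _ i j :=
  GRing.isLinear.Build F _ _ _ (tunit i j) (tunit_linear i j).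

Lemma tblock_linear i j : linear (tblock i j).
Proof. by move=> c x y; apply/matrixP => a b; rewrite !mxE. Qed.
HB.instance Definition _ i j :=
  GRing.isLinear.Build F _ _ _ (tblock i j) (tblock_linear i j).

Lemma tblock_inj x y : (forall i j, tblock i j x = tblock i j y) -> x = y.
Proof.
move=> xy; apply/matrixP => a b.
rewrite -[a](cast_ordKV e) -[b](cast_ordKV e).
case: (mxtens_indexP (cast_ord (esym e) a)) => i a'.
case: (mxtens_indexP (cast_ord (esym e) b)) => j b'.
by have /matrixP/(_ a' b') := xy i j; rewrite !mxE.
Qed.

Lemma tblock_tunit i j i' j' d :
  tblock i j (tunit i' j' d) = if (i == i') && (j == j') then d else 0.
Proof.
apply/matrixP => a b; rewrite mxE castmxE !cast_ordK tensmxE mxE.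
by case: ifP => _; rewrite ?mul1r // mul0r mxE.
Qed.

Lemma tunit_tblock x : x = \sum_i \sum_j tunit i j (tblock i j x).
Proof.
apply: tblock_inj => i j; rewrite linear_sum (bigD1 i) //= [X in _ + X]big1 => [|i' i'i].
  rewrite addr0 linear_sum (bigD1 j) //= big1 => [|j' j'j].
    by rewrite tblock_tunit !eqxx addr0.
  by rewrite tblock_tunit [j == _]eq_sym (negPf j'j) andbF.
rewrite linear_sum big1 // => j' _ /=.
by rewrite tblock_tunit [i == _]eq_sym (negPf i'i).
Qed.

Lemma tblockM i j x y :
  tblock i j (x *m y) = \sum_h tblock i h x *m tblock h j y.
Proof.
apply/matrixP => a b; rewrite mxE [LHS]mxE summxE.
under [RHS]eq_bigr do rewrite mxE.
rewrite pair_big /=.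
rewrite (reindex (fun hc : 'I_k * 'I_l => cast_ord e (mxtens_index hc))) /=.
  by apply: eq_bigr => -[h c] _; rewrite !mxE.
exists (fun z => mxtens_unindex (cast_ord (esym e) z)) => z _.
  by rewrite cast_ordK mxtens_indexK.
by rewrite mxtens_unindexK cast_ordKV.
Qed.

Lemma tblock1 i j : tblock i j 1%:M = (i == j)%:R%:M.
Proof.
apply/matrixP => a b; rewrite !mxE (inj_eq (@cast_ord_inj _ _ _)).
rewrite (inj_eq (can_inj (@mxtens_indexK _ _))) xpair_eqE.
by case: (i == j); case: (a == b).
Qed.

End TensorBlocks.

Record matrix_units (F : fieldType) (k l N : nat)
    (K : 'I_k -> 'I_k -> 'Hom('M[F]_l, 'M[F]_N)) : Prop := {
  munitM : forall i j i' j' d d',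
    K i j d *m K i' j' d' = if j == i' then K i j' (d *m d') else 0;
  munit1 : \sum_i K i i 1%:M = 1%:M }.

Section MatrixUnits.
Variables (F : fieldType) (k l N : nat) (e : (k * l = N)%N).

Lemma tunit_matrix_units : matrix_units (fun i j => linfun (tunit (F := F) e i j)).
Proof.
split=> [i j i' j' d d'|].
  rewrite !lfunE /= ; apply: (tblock_inj (e := e)) => a b; rewrite tblockM.
  transitivity (if (a == i) && (b == j') && (j == i') then d *m d' else 0).
    rewrite (bigD1 j) //= !tblock_tunit eqxx andbT big1 ?addr0 => [|h hj].
      case: (a == i); rewrite ?mul0mx //=.
      case: (j == i') => /=; rewrite ?andbT ?andbF ?mulmx0 //.
      by case: (b == j'); rewrite ?mulmx0.
    by rewrite !tblock_tunit (negPf hj) andbF mul0mx.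
  case: (j == i'); rewrite ?andbT ?andbF ?linear0 //.
  by rewrite tblock_tunit.
apply: (tblock_inj (e := e)) => a b; rewrite linear_sum /=.
under eq_bigr do rewrite lfunE /= tblock_tunit.
rewrite tblock1; case: (a =P b) => [->|/eqP ab].
  rewrite (bigD1 b) //= eqxx big1 ?addr0 // => i ib.
  by rewrite [b == i]eq_sym (negPf ib).
rewrite big1 ?raddf0 // => i _.
by case: (a =P i) => //= ai; rewrite eq_sym -ai (negPf ab).
Qed.

Variables (N' : nat) (K : 'I_k -> 'I_k -> 'Hom('M[F]_l, 'M[F]_N')).
Hypothesis K_units : matrix_units K.

Definition unit_map : 'Hom('M[F]_N, 'M[F]_N') :=
  \sum_i \sum_j (K i j \o linfun (tblock e i j))%VF.

Lemma unit_mapE x : unit_map x = \sum_i \sum_j K i j (tblock e i j x).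
Proof.
rewrite sum_lfunE; apply: eq_bigr => i _; rewrite sum_lfunE.
by apply: eq_bigr => j _; rewrite comp_lfunE lfunE.
Qed.

Lemma unit_map_tunit i j d : unit_map (tunit e i j d) = K i j d.
Proof.
rewrite unit_mapE (bigD1 i) //= [X in _ + X]big1 => [|i' i'i]; last first.
  by rewrite big1 // => j' _; rewrite tblock_tunit (negPf i'i) linear0.
rewrite addr0 (bigD1 j) //= big1 => [|j' j'j]; last first.
  by rewrite tblock_tunit (negPf j'j) andbF linear0.
by rewrite addr0 tblock_tunit !eqxx.
Qed.

Lemma unit_map1 : unit_map 1%:M = 1%:M.
Proof.
rewrite -(munit1 tunit_matrix_units) linear_sum -(munit1 K_units).
by apply: eq_bigr => i _; rewrite /= lfunE /= unit_map_tunit.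
Qed.

Lemma unit_mapM x y : unit_map (x *m y) = unit_map x *m unit_map y.
Proof.
rewrite [unit_map x]unit_mapE mulmx_suml [LHS]unit_mapE.
apply: eq_bigr => i _; rewrite mulmx_suml.
transitivity (\sum_h \sum_j K i j (tblock e i h x *m tblock e h j y)).
  rewrite exchange_big; apply: eq_bigr => j _.
  by rewrite tblockM linear_sum.
apply: eq_bigr => h _; rewrite unit_mapE mulmx_sumr [RHS](bigD1 h) //=.
rewrite [X in _ + X]big1 ?addr0 => [|h' h'h].
  rewrite mulmx_sumr; apply: eq_bigr => j _.
  by rewrite (munitM K_units) eqxx.
rewrite mulmx_sumr big1 // => j _.
by rewrite (munitM K_units) eq_sym (negPf h'h).
Qed.

(** A unital map out of a simple algebra. Besides isomorphisms for [N = N'], this yields the bound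
    on [k * l] in the existence part. *)
Lemma unit_map_inj : (0 < N')%N -> injective unit_map.
Proof.
by move=> N'_gt0; apply: mx_unital_inj => //; [apply: unit_map1 | apply: unit_mapM].
Qed.

End MatrixUnits.

(** * Graded division algebras *)

Section DivisionGrading.
Variables (F : fieldType) (G : zmodType) (l : nat) (D_ : G -> {vspace 'M[F]_l}).

(** The degree 0 component of 1 is a right unit: by the shift rules for projections, [x *m pr 0 1]
    and [x] have the same component in every degree. *)
Lemma grading1 : grading (@mulmx F _ _ _) D_ -> 1%:M \in D_ 0.
Proof.
move=> [decD mulD]; have [s [pr P]] := decomposition_proj decD.
suff pr1 (x : 'M_l) : x *m pr 0 1%:M = x by rewrite -[1%:M]pr1 mul1mx (projD P).
apply: (proj_inj P) => g.
rewrite -{1}[g]addr0 (proj_mulr mulD P) ?(projD P) //.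
rewrite -(proj_mull mulD P _ _ (projD P g x)) mulmx1 addr0.
by rewrite (projE P _ (projD P g x)) eqxx.
Qed.

Hypothesis divD : division_grading (@mulmx F _ _ _) 1%:M D_.

(** Taking components of degree 0 in [x y = 1] shows that the component of [y] of degree [- t] is
    already a right inverse of [x], hence equals [y]. *)
Lemma division_inv t x : x \in D_ t -> x != 0 ->
  exists2 y, y \in D_ (- t) & x *m y = 1%:M /\ y *m x = 1%:M.
Proof.
have [gD invD] := divD; have [decD mulD] := gD.
have [s [pr P]] := decomposition_proj decD.
move=> xt x0; have [y [xy yx]] := invD _ _ xt x0.
suff yE : y = pr (- t) y by exists y; rewrite // yE (projD P).
rewrite -[RHS]mul1mx -yx -mulmxA -(proj_mull mulD P _ _ xt) subrr xy.
by rewrite (projE P _ (grading1 gD)) eqxx mulmx1.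
Qed.

End DivisionGrading.

Lemma exists_eigenvector (F : closedFieldType) (l : nat) (M : 'M[F]_l) :
  (0 < l)%N -> exists a (v : 'rV_l), v != 0 /\ v *m M = a *: v.
Proof.
move=> l_gt0; have : size (char_poly M) != 1 by rewrite size_char_poly eqSS -lt0n.
case/closed_rootP => a; rewrite -eigenvalue_root_char => /eigenvalueP[v vM v0].
by exists a, v.
Qed.

Section ClosedDivisionGrading.
Variables (F : closedFieldType) (G : zmodType) (l : nat).
Variable D_ : G -> {vspace 'M[F]_l}.
Hypothesis divD : division_grading (@mulmx F _ _ _) 1%:M D_.

(** Subtracting an eigenvalue leaves a singular homogeneous element, which has to be 0. *)
Lemma division_deg0 x : x \in D_ 0 -> exists c, x = c%:M.
Proof.
move=> x0; have [l0|l_gt0] := posnP l.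
  by exists 0; apply/matrixP => -[i il]; exfalso; rewrite l0 in il.
have [a [v [v0 vx]]] := exists_eigenvector x l_gt0; exists a.
apply/eqP; rewrite -subr_eq0; apply/negPn/negP => xa0.
have xaD : x - a%:M \in D_ 0.
  by rewrite memvB // -scalemx1 memvZ // grading1 //; case: divD.
have [y _ [xay _]] := division_inv divD xaD xa0.
move/eqP: v0; apply; rewrite -[v]mulmx1 -xay mulmxA mulmxBr vx.
by rewrite mul_mx_scalar subrr mul0mx.
Qed.

(** Multiplication by the inverse of [x] moves [D_ t] into degree 0, where everything is scalar. *)
Lemma division_line t x : x \in D_ t -> x != 0 -> D_ t = <[x]>%VS.
Proof.
move=> xt x0; apply/eqP; rewrite eqEsubv -memvE xt andbT; apply/subvP => z zt.
have [y yt [xy yx]] := division_inv divD xt x0.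
have [[_ mulD] _] := divD.
have : y *m z \in D_ 0 by rewrite -(addNr t); apply: mulD.
case/division_deg0 => c yz; apply/vlineP; exists c.
by rewrite -[z]mul1mx -xy -mulmxA yz mul_mx_scalar.
Qed.

Lemma division_dim t : \dim (D_ t) = (D_ t != 0%VS).
Proof.
case: eqP => [->|/eqP]; first by rewrite dimv0.
rewrite -vpick0 => p0; rewrite (division_line (memv_pick _) p0) dim_vline p0 //.
Qed.

End ClosedDivisionGrading.

(** * The gradings Gamma *)

Section Gamma.
Variables (F : fieldType) (G : zmodType) (m n l : nat) (gamma0 gamma1 : seq G).
Hypotheses (e0 : (size gamma0 * l = m)%N) (e1 : (size gamma1 * l = n)%N).
Variables (T : {fset G}) (D_ : G -> {vspace 'M[F]_l}).
Hypothesis DT : forall t, (t \in T) = (D_ t != 0%VS).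

Let gamma := gamma0 ++ gamma1.
Let e := kron_dim e0 e1.

(** The equation [g_i + t - g_j = g] solved for [t], block by block. [Gamma] has summands only for
    [t] in [T]; by [DT] the remaining components of [D_] are 0. *)
Lemma mem_GammaP g x : x \in Gamma e0 e1 T D_ g <->
  forall i j, tblock e i j x \in D_ (g - gamma`_i + gamma`_j).
Proof.
have kronE i j : kron e0 e1 i j = tunit e i j :> ('M[F]_l -> _) by [].
split=> [+ i j|xD].
  rewrite -[tblock e i j x](lfunE (tblock e i j)) memv_preim; apply: subvP.
  apply/subv_sumP => i' _; apply/subv_sumP => j' _.
  elim/big_ind: _ => [|A B AW BW|t /eqP gt]; first exact: sub0v.
    by rewrite subv_add AW.
  apply/subvP => _ /memv_imgP[d dt ->]; rewrite -memv_preim kronE !lfunE /= tblock_tunit.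
  case: ifP => [/andP[/eqP -> /eqP ->]|_]; last exact: mem0v.
  by rewrite -gt addrAC subrK [_ + t]addrC addrK.
rewrite (tunit_tblock e x); apply: memv_suml => i _; apply: memv_suml => j _.
have := xD i j; set t := _ + _ => dt.
have [tT|tT] := boolP (t \in T); last first.
  by move: tT dt; rewrite DT negbK => /eqP->; rewrite memv0 => /eqP->; rewrite linear0 mem0v.
rewrite /Gamma (subvP (sumv_sup i _ (subvv _))) // (subvP (sumv_sup j _ (subvv _))) //.
rewrite (big_rem t) //= ifT; last by rewrite /t addrA addrK addrC subrK.
apply: (subvP (addvSl _ _)); rewrite -[tunit e i j _](lfunE (tunit e i j)).
exact: memv_img.
Qed.

Lemma Gamma_grading :
  grading (@mulmx F _ _ _) D_ -> grading (@mulmx F _ _ _) (Gamma e0 e1 T D_).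
Proof.
move=> [decD mulD]; split; last first.
  move=> g h x y /mem_GammaP xg /mem_GammaP yh; apply/mem_GammaP => i j.
  rewrite tblockM; apply: memv_suml => k _.
  have -> : g + h - gamma`_i + gamma`_j
          = (g - gamma`_i + gamma`_k) + (h - gamma`_k + gamma`_j).
    by rewrite addrA [h - _]addrC addrA addrK [g + h - _]addrAC.
  exact: mulD.
have [s [pr P]] := decomposition_proj decD.
(* On block [(i, j)] the projection of degree [g] is the projection of [D_] in the degree prescribed
   by [mem_GammaP]. *)
pose q g : 'End('M[F]_(m + n)) := \sum_i \sum_j
  (linfun (tunit e i j) \o pr (g - gamma`_i + gamma`_j) \o linfun (tblock e i j))%VF.
have qE g x i j : tblock e i j (q g x) = pr (g - gamma`_i + gamma`_j) (tblock e i j x).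
  rewrite /q sum_lfunE linear_sum (bigD1 i) //= [X in _ + X]big1 => [|i' i'i].
    rewrite addr0 sum_lfunE linear_sum (bigD1 j) //= [X in _ + X]big1 => [|j' j'j].
      by rewrite !comp_lfunE !lfunE /= tblock_tunit !eqxx addr0.
    by rewrite !comp_lfunE !lfunE /= tblock_tunit [j == _]eq_sym (negPf j'j) andbF.
  rewrite sum_lfunE linear_sum big1 // => j' _.
  by rewrite !comp_lfunE !lfunE /= tblock_tunit [i == _]eq_sym (negPf i'i).
pose S := undup [seq t + gamma`_(ij : 'I__ * 'I__).1 - gamma`_ij.2 | t <- s,
  ij <- enum {: 'I_(size gamma0 + size gamma1) * 'I_(size gamma0 + size gamma1)}].
have Pq : projections (Gamma e0 e1 T D_) S q; last exact: proj_decomposition Pq.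
split.
- by move=> g v; apply/mem_GammaP => i j; rewrite qE (projD P).
- move=> g h v /mem_GammaP vh; apply: (tblock_inj (e := e)) => i j.
  rewrite qE (projE P _ (vh i j)) (inj_eq (addIr _)) (inj_eq (addIr _)).
  by case: ifP; rewrite ?linear0.
- move=> v; apply: (tblock_inj (e := e)) => i j; rewrite linear_sum /=.
  under eq_bigr do rewrite qE.
  rewrite -[RHS](big_map (fun h => h - gamma`_i + gamma`_j) xpredT
    (fun h => pr h (tblock e i j v))).
  apply: (proj_sum_supp P).
    by rewrite map_inj_uniq ?undup_uniq // => g h /addIr/addIr.
  move=> h; apply: contraNeq => ph.
  have hs : h \in s by apply: contra_neqT ph; exact: proj_supp P.
  apply/mapP; exists (h + gamma`_i - gamma`_j); last by rewrite addrAC subrK addrK.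
  rewrite mem_undup; apply/allpairsP; exists (h, (i, j)).
  by rewrite /= mem_enum.
Qed.

End Gamma.

(** * The isomorphism criterion for [Gamma] *)

Section GammaIso.
Variables (F : fieldType) (G : zmodType) (m n l : nat) (gamma0 gamma1 : seq G).
Hypotheses (e0 : (size gamma0 * l = m)%N) (e1 : (size gamma1 * l = n)%N).
Let gamma := gamma0 ++ gamma1.
Let e := kron_dim e0 e1.

Lemma parity_mxE (x y : 'I_(m + n)) :
  parity_mx F m n x y = ((x == y) && (x < m)%N)%:R.
Proof.
rewrite /parity_mx; case: (split_ordP x) => i ->; case: (split_ordP y) => j ->.
- by rewrite block_mxEul mxE (inj_eq (@lshift_inj _ _)) /= andbT.
- by rewrite block_mxEur mxE eq_lrshift.
- by rewrite block_mxEdl mxE eq_rlshift.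
- by rewrite block_mxEdr mxE /= andbF.
Qed.

Lemma parity_mx_tunit :
  parity_mx F m n = \sum_i tunit e (lshift _ i) (lshift _ i) 1%:M.
Proof.
apply: (tblock_inj (e := e)) => i j; rewrite linear_sum /=.
under eq_bigr do rewrite tblock_tunit.
transitivity (if (i == j) && (i < size gamma0)%N then 1%:M else 0 : 'M[F]_l).
  apply/matrixP => a b; rewrite mxE parity_mxE (inj_eq (@cast_ord_inj _ _ _)).
  rewrite (inj_eq (can_inj (@mxtens_indexK _ _))) xpair_eqE /=.
  have -> : (i * l + a < m)%N = (i < size gamma0)%N.
    have l_gt0 : (0 < l)%N by apply: leq_ltn_trans (ltn_ord a).
    by rewrite -e0 -ltn_divLR // divnMDl // divn_small ?addn0.
  case: (i == j) => /=; last by rewrite mxE.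
  by rewrite andbC; case: ifP; rewrite mxE.
case: (split_ordP i) => i' ->; last first.
  rewrite andbF big1 // => h _.
  by rewrite eq_rlshift.
rewrite andbT (bigD1 i') //= eqxx [j == _]eq_sym big1 ?addr0 // => h hi.
by rewrite (inj_eq (@lshift_inj _ _)) [i' == h]eq_sym (negPf hi).
Qed.

Lemma parity_mx_tunit_r :
  1%:M - parity_mx F m n = \sum_i tunit e (rshift _ i) (rshift _ i) 1%:M.
Proof.
have [_ <-] := tunit_matrix_units F e.
rewrite big_split_ord /= parity_mx_tunit.
under eq_bigr do rewrite lfunE.
under [X in _ + X - _]eq_bigr do rewrite lfunE.
by rewrite addrAC subrr add0r.
Qed.

Variables (T : {fset G}) (D_ : G -> {vspace 'M[F]_l}).
Hypotheses (DT : forall t, (t \in T) = (D_ t != 0%VS))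
           (gD : grading (@mulmx F _ _ _) D_).
Variables (A_ : G -> {vspace 'M[F]_(m + n)}).
Variable K : 'I_(size gamma0 + size gamma1) -> 'I_(size gamma0 + size gamma1) ->
  'Hom('M[F]_l, 'M[F]_(m + n)).

(** The degrees of [K] give only the inclusion of the image of each component in [A_ g]. As both
    sides are decompositions, [phi] then commutes with the projections, and being bijective it maps
    onto each [A_ g]. *)
Lemma Gamma_iso : (0 < m + n)%N -> decomposition A_ -> matrix_units K ->
    (forall i j t d, d \in D_ t -> K i j d \in A_ (gamma`_i + t - gamma`_j)) ->
    (let p := \sum_i K (lshift _ i) (lshift _ i) 1%:M in
     p = parity_mx F m n \/ p = 1%:M - parity_mx F m n) ->
  grading_iso (Gamma e0 e1 T D_) A_.
Proof.
move=> N_gt0 decA K_units KA Kp.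
pose phi := unit_map e K.
have phi_inj : injective phi by apply: unit_map_inj.
have phi1 : phi 1%:M = 1%:M by apply: unit_map1.
have phiM : forall x y, phi (x *m y) = phi x *m phi y by apply: unit_mapM.
exists phi; split.
  apply: parity_super_automorphism => //.
  rewrite {1 3}parity_mx_tunit linear_sum /=.
  by under eq_bigr do rewrite unit_map_tunit.
have sub g : (phi @: Gamma e0 e1 T D_ g <= A_ g)%VS.
  apply/subvP => _ /memv_imgP[x /(mem_GammaP e0 e1 DT) xg ->].
  rewrite unit_mapE; apply: memv_suml => i _; apply: memv_suml => j _.
  have gE : gamma`_i + (g - gamma`_i + gamma`_j) - gamma`_j = g.
    by rewrite addrA addrK addrC subrK.
  by rewrite -gE; apply/KA/xg.
have [decG _] := Gamma_grading e0 e1 DT gD.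
have [s [q Q]] := decomposition_proj decG.
have [r [pr P]] := decomposition_proj decA.
have ker0 : lker phi == 0%VS by apply/lker0P.
move=> g; apply/eqP; rewrite eqEsubv sub /=; apply/subvP => a ag.
set x := (phi^-1)%VF a; have xa : phi x = a by rewrite /x lker0_lfunVK.
have prphi h : pr h (phi x) = phi (q h x).
  rewrite {1}[x](proj_sum Q) !linear_sum.
  transitivity (\sum_(k <- s) phi (q h (q k x))); last by rewrite -!linear_sum -(proj_sum Q).
  apply: eq_bigr => k _ /=; rewrite (projE Q _ (projD Q k x)).
  rewrite (projE P h (subvP (sub k) _ (memv_img _ (projD Q k x)))).
  by case: ifP; rewrite ?linear0.
have := prphi g; rewrite xa (projE P _ ag) eqxx => ->.
by apply: memv_img; apply: (projD Q).
Qed.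

End GammaIso.

(** * Isomorphisms from equality of multisets *)

Section Cosets.
Variables (G : zmodType) (T : {fset G}).
Hypothesis sT : subgroup T.

Lemma subgroup_opp t : t \in T -> - t \in T.
Proof. by case: sT => T0 TB tT; rewrite -sub0r TB. Qed.

Lemma subgroup_add t u : t \in T -> u \in T -> t + u \in T.
Proof. by case: sT => T0 TB tT uT; rewrite -[u]opprK TB // subgroup_opp. Qed.

Lemma mem_translate g x : (x \in translate g T) = (x - g \in T).
Proof.
apply/imfsetP/idP => [[t /= tT ->]|xT]; first by rewrite addrC addKr.
by exists (x - g); rewrite //= addrC subrK.
Qed.

Lemma translate_eqP a b : translate a T = translate b T <-> b - a \in T.
Proof.
split=> [ab|ba].
  by rewrite -mem_translate ab mem_translate subrr; case: sT.
apply/fsetP => x; rewrite !mem_translate.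
have -> : x - a = x - b + (b - a) by rewrite addrA subrK.
apply/idP/idP => [xT|xT]; last exact: subgroup_add.
by rewrite -[x - b](addrK (b - a)) subgroup_add // subgroup_opp.
Qed.

Lemma act_mset_XiP g gamma gamma' : act_mset g (Xi T gamma) = Xi T gamma' <->
  perm_eq [seq translate (g + a) T | a <- gamma] [seq translate a T | a <- gamma'].
Proof.
have P : perm_eq [seq translate g C | C <- Xi T gamma]
                 [seq translate (g + a) T | a <- gamma].
  have -> : [seq translate (g + a) T | a <- gamma]
          = [seq translate g C | C <- [seq translate a T | a <- gamma]].
    rewrite -map_comp; apply: eq_map => a /=; apply/fsetP => x.
    rewrite mem_translate; apply/idP/imfsetP => [xT|[y /= + ->]].
      exists (x - g) => /=; last by rewrite addrC subrK.
      by rewrite mem_translate -addrA -opprD.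
    by rewrite mem_translate opprD addrA [g + y]addrC addrK.
  exact/perm_map/perm_eq_seq_mset.
by split=> [/eq_seq_msetP|] h; [|apply/eq_seq_msetP];
   rewrite -(permPl P) in h *.
Qed.

End Cosets.

Lemma perm_eq_bij (X : eqType) (x0 : X) (s s' : seq X) : perm_eq s s' ->
  exists sigma : 'I_(size s) -> 'I_(size s'), bijective sigma /\
    forall i : 'I_(size s), nth x0 s i = nth x0 s' (sigma i).
Proof.
move=> ss'; have eq_size := perm_size ss'.
have [Is IsP sE] := perm_iotaP x0 ss'.
have sizeI : size Is = size s by rewrite (perm_size IsP) size_iota.
have IsI (i : 'I_(size s)) : (nth 0%N Is i < size s')%N.
  have : nth 0%N Is i \in iota 0 (size s').
    by rewrite -(perm_mem IsP) mem_nth // sizeI.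
  by rewrite mem_iota.
exists (fun i => Ordinal (IsI i)); split.
  apply: inj_card_bij; last by rewrite !card_ord eq_size.
  move=> i j /(congr1 val) /= /eqP; rewrite nth_uniq ?sizeI //.
    by move/eqP/val_inj.
  by rewrite (perm_uniq IsP) iota_uniq.
by move=> i; rewrite {1}sE (nth_map 0%N) // sizeI.
Qed.

(** Entries are matched only modulo [T]; the discrepancy, an element of [T], will be the degree of a
    correcting unit of the division algebra. *)
Lemma Xi_bij (G : zmodType) (T : {fset G}) (g : G) (gamma gamma' : seq G) :
    subgroup T -> act_mset g (Xi T gamma) = Xi T gamma' ->
  exists sigma : 'I_(size gamma) -> 'I_(size gamma'), bijective sigma /\
    forall i : 'I_(size gamma), gamma'`_(sigma i) - (g + gamma`_i) \in T.
Proof.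
move=> sT /(act_mset_XiP)/(perm_eq_bij fset0).
rewrite !size_map => -[sigma [sb sE]]; exists sigma; split=> // i.
by apply/translate_eqP => //; have := sE i; rewrite !(nth_map 0).
Qed.

(** * Simultaneous eigenvectors and conjugacy of realizations *)

Section Intertwiner.
Variable F : closedFieldType.

Lemma exists_eigenvector_in (V : vectType F) (f : 'End(V)) (U : {vspace V}) :
    U != 0%VS -> (f @: U <= U)%VS ->
  exists a u, [/\ u \in U, u != 0 & f u = a *: u].
Proof.
move=> U0 fU; pose b := vbasis U.
pose M : 'M[F]_(\dim U) := \matrix_(i, j) coord b j (f b`_i).
have dU : (0 < \dim U)%N by rewrite lt0n dimv_eq0.
have [a [v [v0 vM]]] := exists_eigenvector M dU.
have bU (i : 'I_(\dim U)) : b`_i \in U by rewrite vbasis_mem // mem_nth // size_tuple.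
pose u := \sum_i v 0 i *: b`_i; exists a, u; split.
- by apply: memv_suml => i _; rewrite memvZ.
- apply: contraNneq v0 => u0; apply/eqP/rowP => i; rewrite mxE.
  by have /freeP/(_ (v 0) u0) := basis_free (vbasisP U).
rewrite linear_sum scaler_sumr /=.
transitivity (\sum_j (v *m M) 0 j *: b`_j).
  under [RHS]eq_bigr do rewrite mxE scaler_suml.
  rewrite exchange_big; apply: eq_bigr => i _ /=.
  rewrite linearZ /= {1}(coord_vbasis (subvP fU _ (memv_img f (bU i)))) scaler_sumr.
  by apply: eq_bigr => j _; rewrite scalerA mxE.
by apply: eq_bigr => j _; rewrite vM mxE scalerA.
Qed.

(** Commuting operators preserve each other's eigenspaces, so [U] can be cut down one operator at a
    time. *)
Lemma common_eigenvector (V : vectType F) (fs : seq 'End(V)) (U : {vspace V}) :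
    U != 0%VS -> {in fs, forall f : 'End(V), (f @: U <= U)%VS} ->
    {in fs &, forall f g : 'End(V), forall v, f (g v) = g (f v)} ->
  exists u, [/\ u \in U, u != 0 & {in fs, forall f : 'End(V), exists a, f u = a *: u}].
Proof.
elim: fs U => [|f fs IH] U U0 fU fC.
  by exists (vpick U); rewrite memv_pick vpick0.
have [a [u [uU u0 fu]]] := exists_eigenvector_in U0 (fU f (mem_head _ _)).
pose W := (U :&: lker (f - a *: \1%VF))%VS.
have memW w : (w \in W) = (w \in U) && (f w == a *: w).
  by rewrite memv_cap memv_ker add_lfunE opp_lfunE scale_lfunE id_lfunE subr_eq0.
have [|||w [wW w0 fw]] := IH W.
- by apply: contraNneq u0 => W0; rewrite -memv0 -W0 memW uU fu eqxx.
- move=> h hfs; apply/subvP => _ /memv_imgP[w + ->]; rewrite !memW => /andP[wU /eqP fw].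
  rewrite (subvP (fU h _)) ?memv_img ?in_cons ?hfs ?orbT //=.
  by rewrite fC ?in_cons ?eqxx ?hfs ?orbT // fw linearZ.
- by move=> h k hfs kfs; apply: fC; rewrite in_cons ?hfs ?kfs orbT.
move: wW; rewrite memW => /andP[wU /eqP fww]; exists w; split=> // h.
by rewrite in_cons => /predU1P[->|/fw //]; exists a.
Qed.

Variables (G : zmodType) (T : {fset G}) (l : nat).

(* The operators [M |-> X'_t M X_t^-1] commute, because the commutation factors
   of the two algebras cancel; a common eigenvector is an intertwiner. *)
Lemma realization_conj (beta beta' : G -> G -> F) (D_ D'_ : G -> {vspace 'M[F]_l}) :
    (0 < l)%N -> nondeg_alt_bicharacter T beta ->
    {in T &, forall u v, beta u v = beta' u v} ->
    realizes T beta D_ -> realizes T beta' D'_ ->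
  exists2 P, P \in unitmx &
    forall t x, x \in D_ t -> P *m x *m invmx P \in D'_ t.
Proof.
move=> l_gt0 bT bb' [_ divD DT Dc] [_ divD' DT' Dc'].
have pickD (B_ : G -> {vspace 'M[F]_l}) :
    division_grading (@mulmx F _ _ _) 1%:M B_ ->
    (forall t, (t \in T) = (B_ t != 0%VS)) ->
    {in T, forall t, vpick (B_ t) \in unitmx}.
  move=> divB BT t; rewrite BT -vpick0 => Xt.
  have [y _ [xy _]] := division_inv divB (memv_pick _) Xt.
  by case: (mulmx1_unit xy).
pose X t := vpick (D_ t); pose X' t := vpick (D'_ t).
have XU : {in T, forall t, X t \in unitmx} := pickD _ divD DT.
have XU' : {in T, forall t, X' t \in unitmx} := pickD _ divD' DT'.
pose S t : 'End('M[F]_l) := linfun (mulmxr (invmx (X t)) \o mulmx (X' t)).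
have SE t M : S t M = X' t *m M *m invmx (X t) by rewrite lfunE.
have [|||P [_ P0 PS]] := @common_eigenvector _ [seq S t | t <- T] fullv.
- by rewrite -dimv_eq0 dimvf dim_matrix muln_eq0 orbb -lt0n.
- by move=> f _; apply: subvf.
- move=> _ _ /mapP[u uT ->] /mapP[v vT ->] M; rewrite !SE.
  have X'c : X' u *m X' v = beta u v *: (X' v *m X' u).
    by rewrite bb' //; apply: Dc'; rewrite ?memv_pick.
  have Xc : X u *m X v = beta u v *: (X v *m X u).
    by apply: Dc; rewrite ?memv_pick.
  have Xi : invmx (X v) *m invmx (X u) = (beta u v)^-1 *: (invmx (X u) *m invmx (X v)).
    have uv_unit : X u *m X v \in unitmx by rewrite unitmx_mul XU ?XU.
    apply: (can_inj (mulKmx uv_unit)).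
    rewrite -scalemxAr [in RHS]Xc -scalemxAl scalerA mulVf ?(bichar_neq0 bT) // scale1r.
    by rewrite !mulmxA !mulmxK ?mulmxV ?XU.
  rewrite !mulmxA X'c -!mulmxA Xi -!scalemxAl -!scalemxAr scalerA.
  by rewrite mulfV ?(bichar_neq0 bT) // scale1r !mulmxA.
have PX t x : x \in D_ t -> exists2 x', x' \in D'_ t & P *m x = x' *m P.
  have [tT|] := boolP (t \in T); last first.
    rewrite DT negbK => /eqP->; rewrite memv0 => /eqP->.
    by exists 0; rewrite ?mem0v // mulmx0 mul0mx.
  have Xt0 : X t != 0 by rewrite vpick0 -DT.
  rewrite (division_line divD (memv_pick _) Xt0) => /vlineP[k ->].
  have [c] := PS (S t) (map_f S tT); rewrite SE => /(congr1 (mulmxr (X t))) /=.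
  rewrite mulmxKV ?XU // => X'P.
  have c0 : c != 0.
    apply: contraNneq P0 => c0; move: X'P; rewrite c0 scale0r mul0mx => X'P.
    by rewrite -[P](mulKmx (XU' t tT)) X'P mulmx0.
  exists (k *: (c^-1 *: X' t)); first by rewrite !memvZ ?memv_pick.
  by rewrite -!scalemxAl X'P -scalemxAl [c^-1 *: _]scalerA mulVf // scale1r scalemxAr.
have PM x : exists x', P *m x = x' *m P.
  have [[decD _] _] := divD; have [s [pr pP]] := decomposition_proj decD.
  rewrite [x](proj_sum pP); elim: (s) => [|h r [x' IH]].
    by exists 0; rewrite big_nil mulmx0 mul0mx.
  have [y _ Py] := PX h _ (projD pP h x); exists (y + x').
  by rewrite big_cons mulmxDr IH Py mulmxDl.
(* By [PM] every [P r] is a left multiple of [P], hence kills [cokermx P]; as [P] is nonzero,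
   primeness makes the cokernel 0. *)
have Pu : P \in unitmx.
  rewrite -row_full_unit /row_full eqn_leq rank_leq_col -subn_eq0 -mxrank_coker.
  rewrite mxrank_eq0.
  apply/negPn/negP => /(mx_prime P0)[r]; have [x' ->] := PM r.
  by rewrite -mulmxA mulmx_coker mulmx0 eqxx.
exists P => // t x /PX[x' x'D ->]; by rewrite mulmxK.
Qed.

End Intertwiner.

Lemma split_lshift (a b : nat) (i : 'I_a) : split (lshift b i) = inl i.
Proof. exact: (unsplitK (inl i)). Qed.

Lemma split_rshift (a b : nat) (i : 'I_b) : split (rshift a i) = inr i.
Proof. exact: (unsplitK (inr i)). Qed.

(** * Isomorphisms from bijections of indices *)

Section GammaOfXi.
Variables (F : closedFieldType) (G : zmodType) (m n l : nat) (T : {fset G}).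
Variables (beta beta' : G -> G -> F) (D_ D'_ : G -> {vspace 'M[F]_l}).
Variables (gamma0 gamma1 gamma0' gamma1' : seq G).
Hypotheses (e0 : (size gamma0 * l = m)%N) (e1 : (size gamma1 * l = n)%N).
Hypotheses (e0' : (size gamma0' * l = m)%N) (e1' : (size gamma1' * l = n)%N).
Hypotheses (divD : division_data T beta D_) (divD' : division_data T beta' D'_).
Hypothesis eq_beta : {in T &, forall u v, beta u v = beta' u v}.

Lemma division_data_size_gt0 : (0 < l)%N.
Proof.
have [[T0 _] _ [card_T _ _ _]] := divD.
by rewrite -sqrn_gt0 card_T cardfs_gt0; apply/fset0Pn; exists 0.
Qed.

(** The units are [E_(sigma i)(sigma j)] tensored with [W_i^-1 (P d P^-1) W_j]: the intertwiner [P]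
    carries [D_] to [D'_], the homogeneous units [W_i] absorb the discrepancies in [T], and [g]
    cancels in the degrees. For [i = j] and [d = 1] both corrections disappear, so parity depends on
    [sigma] alone. *)
Lemma Gamma_iso_of_bij (g : G)
    (sigma : 'I_(size gamma0 + size gamma1) -> 'I_(size gamma0' + size gamma1')) :
    (0 < m + n)%N -> bijective sigma ->
    (forall i, (gamma0' ++ gamma1')`_(sigma i) - (g + (gamma0 ++ gamma1)`_i) \in T) ->
    (let e' := kron_dim e0' e1' in
     let p := \sum_i tunit e' (sigma (lshift _ i)) (sigma (lshift _ i)) 1%:M in
     p = parity_mx F m n \/ p = 1%:M - parity_mx F m n) ->
  grading_iso (Gamma e0 e1 T D_) (Gamma e0' e1' T D'_).
Proof.
move=> N_gt0 sigma_bij sigmaT sigma_parity.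
have [sT bT realD] := divD; have [_ _ realD'] := divD'.
have [_ [gD _] DT _] := realD; have [_ div' DT' _] := realD'.
have [gD' _] := div'; have [decD' mulD'] := gD'.
have l_gt0 := division_data_size_gt0.
have [P Pu PD] := realization_conj l_gt0 bT eq_beta realD realD'.
pose gam := gamma0 ++ gamma1; pose gam' := gamma0' ++ gamma1'.
pose t i := gam'`_(sigma i) - (g + gam`_i).
pose W i := vpick (D'_ (t i)).
have WU i : W i \in unitmx.
  have := sigmaT i; rewrite DT' -vpick0 -/(W i) => W0.
  have [y _ [xy _]] := division_inv div' (memv_pick _) W0.
  by case: (mulmx1_unit xy).
have WiD i : invmx (W i) \in D'_ (- t i).
  have := sigmaT i; rewrite DT' -vpick0 -/(W i) => W0.
  have [y yD [xy yx]] := division_inv div' (memv_pick _) W0.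
  suff <- : y = invmx (W i) by [].
  by rewrite -[y]mulmx1 -(mulmxV (WU i)) mulmxA yx mul1mx.
pose e' := kron_dim e0' e1'.
pose C i j (d : 'M[F]_l) := invmx (W i) *m (P *m d *m invmx P) *m W j.
pose K i j : 'Hom('M[F]_l, 'M[F]_(m + n)) :=
  linfun (tunit e' (sigma i) (sigma j) \o
    (mulmxr (W j) \o (mulmx (invmx (W i)) \o (mulmxr (invmx P) \o mulmx P)))).
have KE i j d : K i j d = tunit e' (sigma i) (sigma j) (C i j d) by rewrite lfunE.
have K1 i : K i i 1%:M = tunit e' (sigma i) (sigma i) 1%:M.
  by rewrite KE /C mulmx1 mulmxV // mulmx1 mulVmx.
have sigma_inj := bij_inj sigma_bij.
have [tuM tu1] := @tunit_matrix_units F _ _ _ e'.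
have tuM' i j i' j' (d d' : 'M[F]_l) : tunit e' i j d *m tunit e' i' j' d' =
    if j == i' then tunit e' i j' (d *m d') else 0.
  by have := tuM i j i' j' d d'; rewrite !lfunE.
apply: (Gamma_iso e0 e1 DT gD (K := K)) => //.
- by have [] := Gamma_grading e0' e1' DT' gD'.
- split=> [i j i' j' d d'|].
    rewrite !KE tuM' (inj_eq sigma_inj); case: eqP => // <-; congr tunit.
    by rewrite /C !mulmxA mulmxK // mulmxKV.
  rewrite -tu1 (reindex sigma) /=; last exact: onW_bij.
  by apply: eq_bigr => i _; rewrite K1 lfunE.
- move=> i j u d ud; apply/(mem_GammaP e0' e1' DT') => a b.
  rewrite KE tblock_tunit; case: ifP => [/andP[/eqP-> /eqP->]|_]; last exact: mem0v.
  have -> : gam`_i + u - gam`_j - gam'`_(sigma i) + gam'`_(sigma j) = - t i + u + t j.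
    rewrite /t opprB opprD [gam'`_(sigma j) + _]addrC addrA; congr (_ + _).
    rewrite [g + _]addrC -!addrA; congr (_ + _).
    rewrite [u + (- g + _)]addrCA [- gam'`_(sigma i) + (- g + _)]addrCA addNKr.
    by rewrite [RHS]addrCA [- gam`_j + _]addrC.
  by apply: (mulD' _ _ _ _ (mulD' _ _ _ _ (WiD i) (PD _ _ ud))); apply: memv_pick.
by rewrite /=; under eq_bigr do rewrite K1.
Qed.

Lemma nth_cat_lshift (s0 s1 : seq G) (i : 'I_(size s0)) :
  (s0 ++ s1)`_(lshift (size s1) i) = s0`_i.
Proof. by rewrite nth_cat /= ltn_ord. Qed.

Lemma nth_cat_rshift (s0 s1 : seq G) (i : 'I_(size s1)) :
  (s0 ++ s1)`_(rshift (size s0) i) = s1`_i.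
Proof. by rewrite nth_cat /= ltnNge leq_addr /= addKn. Qed.

Lemma Gamma_iso_of_Xi g : (0 < m + n)%N ->
    act_mset g (Xi T gamma0) = Xi T gamma0' ->
    act_mset g (Xi T gamma1) = Xi T gamma1' ->
  grading_iso (Gamma e0 e1 T D_) (Gamma e0' e1' T D'_).
Proof.
move=> N_gt0; have [sT _ _] := divD.
move=> /(Xi_bij sT)[s0 [[r0 s0K r0K] s0T]] /(Xi_bij sT)[s1 [[r1 s1K r1K] s1T]].
pose sigma x := match split x with
  inl i => lshift (size gamma1') (s0 i) | inr j => rshift (size gamma0') (s1 j) end.
pose rho x := match split x with
  inl i => lshift (size gamma1) (r0 i) | inr j => rshift (size gamma0) (r1 j) end.
have sigmal i : sigma (lshift _ i) = lshift _ (s0 i) by rewrite /sigma split_lshift.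
have sigmar i : sigma (rshift _ i) = rshift _ (s1 i) by rewrite /sigma split_rshift.
apply: (@Gamma_iso_of_bij g sigma) => //.
- exists rho => x; case: (split_ordP x) => i ->.
  + by rewrite sigmal /rho split_lshift s0K.
  + by rewrite sigmar /rho split_rshift s1K.
  + by rewrite /rho split_lshift sigmal r0K.
  + by rewrite /rho split_rshift sigmar r1K.
- move=> x; case: (split_ordP x) => i ->.
    by rewrite sigmal !nth_cat_lshift.
  by rewrite sigmar !nth_cat_rshift.
move=> e' p; left; rewrite (parity_mx_tunit F e0' e1') (reindex s0) /=; last first.
  by apply: onW_bij; exists r0.
by apply: eq_bigr => i _; rewrite sigmal.
Qed.

(** Here [sigma] exchanges the two groups of indices, so that the parity idempotent goes to its
    complement. *)
Lemma Gamma_iso_of_Xi_swap g : (0 < m + n)%N ->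
    act_mset g (Xi T gamma0) = Xi T gamma1' ->
    act_mset g (Xi T gamma1) = Xi T gamma0' ->
  grading_iso (Gamma e0 e1 T D_) (Gamma e0' e1' T D'_).
Proof.
move=> N_gt0; have [sT _ _] := divD.
move=> /(Xi_bij sT)[s0 [[r0 s0K r0K] s0T]] /(Xi_bij sT)[s1 [[r1 s1K r1K] s1T]].
pose sigma x := match split x with
  inl i => rshift (size gamma0') (s0 i) | inr j => lshift (size gamma1') (s1 j) end.
pose rho x := match split x with
  inl j => rshift (size gamma0) (r1 j) | inr i => lshift (size gamma1) (r0 i) end.
have sigmal i : sigma (lshift _ i) = rshift _ (s0 i) by rewrite /sigma split_lshift.
have sigmar i : sigma (rshift _ i) = lshift _ (s1 i) by rewrite /sigma split_rshift.
apply: (@Gamma_iso_of_bij g sigma) => //.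
- exists rho => x; case: (split_ordP x) => i ->.
  + by rewrite sigmal /rho split_rshift s0K.
  + by rewrite sigmar /rho split_lshift s1K.
  + by rewrite /rho split_lshift sigmar r1K.
  + by rewrite /rho split_rshift sigmal r0K.
- move=> x; case: (split_ordP x) => i ->.
    by rewrite sigmal nth_cat_lshift nth_cat_rshift.
  by rewrite sigmar nth_cat_rshift nth_cat_lshift.
move=> e' p; right; rewrite (parity_mx_tunit_r F e0' e1') (reindex s0) /=; last first.
  by apply: onW_bij; exists r0.
by apply: eq_bigr => i _; rewrite sigmal.
Qed.

End GammaOfXi.

(** * Invariants of Gamma *)

Section Corners.
Variables (F : fieldType) (k l N : nat) (e : (k * l = N)%N).

Lemma tunit_inj (i j : 'I_k) : injective (tunit (F := F) e i j).
Proof. by move=> d d' /(congr1 (tblock e i j)); rewrite !tblock_tunit !eqxx. Qed.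

Lemma tunitM (i j i' j' : 'I_k) (d d' : 'M[F]_l) :
  tunit e i j d *m tunit e i' j' d' = if j == i' then tunit e i j' (d *m d') else 0.
Proof. by have := munitM (tunit_matrix_units F e) i j i' j' d d'; rewrite !lfunE. Qed.

Lemma tblock_tunit_mull (a b i j : 'I_k) d z :
  tblock e a b (tunit e i j d *m z) = if a == i then d *m tblock e j b z else 0 :> 'M[F]_l.
Proof.
rewrite tblockM (bigD1 j) //= big1 => [|h hj].
  by rewrite addr0 tblock_tunit eqxx andbT; case: eqP; rewrite ?mul0mx.
by rewrite tblock_tunit (negPf hj) andbF mul0mx.
Qed.

Lemma tblock_tunit_mulr (a b i j : 'I_k) d z :
  tblock e a b (z *m tunit e i j d) = if b == j then tblock e a i z *m d else 0 :> 'M[F]_l.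
Proof.
rewrite tblockM (bigD1 i) //= big1 => [|h hi].
  by rewrite addr0 tblock_tunit eqxx; case: eqP; rewrite ?mulmx0.
by rewrite tblock_tunit (negPf hi) mulmx0.
Qed.

Lemma tunit_corner (i j : 'I_k) (z : 'M[F]_N) :
  tunit e i i 1%:M *m z *m tunit e j j 1%:M = tunit e i j (tblock e i j z).
Proof.
apply: (tblock_inj (e := e)) => a b.
rewrite tblock_tunit_mulr tblock_tunit_mull tblock_tunit.
case: (b =P j) => [_|_]; last by rewrite andbF.
by case: (a =P i) => [_|_]; rewrite ?mul0mx //= mulmx1 mul1mx.
Qed.

End Corners.

(** States that [q A q], with unit [q], is a graded division algebra. Elements of the corner are
    described by [q x q = x] inside the matrix algebra, so that the corner need not be a type;
    inverses are asked for on the right. *)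
Definition division_corner (F : fieldType) (G : zmodType) (N : nat)
    (A_ : G -> {vspace 'M[F]_N}) (q : 'M[F]_N) : Prop :=
  [/\ q \in A_ 0, q != 0, q *m q = q
    & forall g x, x \in A_ g -> x != 0 -> q *m x *m q = x ->
      exists z, [/\ z \in A_ (- g), q *m z *m q = z & x *m z = q]].

(** Put [x = f q]. Primeness gives [r], which may be taken homogeneous, with [x r f] nonzero; this
    element of the corner of [f] has an inverse [z], and [y = q r z] satisfies [x y = f]. *)
Lemma division_corner_equiv (F : fieldType) (G : zmodType) (N : nat)
    (A_ : G -> {vspace 'M[F]_N}) (q f : 'M[F]_N) :
    grading (@mulmx F _ _ _) A_ -> division_corner A_ q -> division_corner A_ f ->
    f *m q != 0 ->
  exists x y, [/\ x \in A_ 0, y \in A_ 0, f *m x = x, y *m f = y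
    & x *m y = f /\ y *m x = q].
Proof.
move=> [decA mulA] [q0A q0 qq qdiv] [f0A f0 ff fdiv] fq0.
have [s [pr P]] := decomposition_proj decA.
have [r] := mx_prime fq0 f0; set x := f *m q in fq0 * => xrf.
have xA : x \in A_ 0 by rewrite -[0]addr0 mulA.
have [h xhf] : exists h, x *m pr h r *m f != 0.
  have [/allP r0|/allPn[h _ hr]] := boolP (all (fun h => x *m pr h r *m f == 0) s).
    move: xrf; rewrite (proj_sum P r) mulmx_sumr mulmx_suml big_seq big1 ?eqxx //.
    by move=> h /r0/eqP.
  by exists h.
have xhfA : x *m pr h r *m f \in A_ h.
  by rewrite -[h in A_ h]addr0 mulA // -[h in A_ h]add0r mulA // (projD P).
have [|z [zA fzf xz]] := fdiv _ _ xhfA xhf.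
  by rewrite -!mulmxA ff !mulmxA ff.
have fx : f *m x = x by rewrite mulmxA ff.
have fz : f *m z = z by rewrite -fzf !mulmxA ff.
have zf : z *m f = z by rewrite -fzf -!mulmxA ff.
have xq : x *m q = x by rewrite -mulmxA qq.
pose y := q *m pr h r *m z.
have yA : y \in A_ 0.
  by rewrite -(subrr h) mulA // -[h in A_ h]add0r mulA // (projD P).
have xy : x *m y = f by rewrite /y !mulmxA xq -fz !mulmxA.
have yf : y *m f = y by rewrite /y -mulmxA zf.
have qy : q *m y = y by rewrite /y !mulmxA qq.
clearbody x y.
exists x, y; split=> //; split=> //.
(* Conversely [y x] is a nonzero idempotent of degree 0 in the corner of [q]; it is invertible
   there, hence equal to [q]. *)
have yx0 : y *m x != 0.
  by apply: contraNneq fq0 => yx; rewrite -{1}fx -xy -mulmxA yx mulmx0.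
have [|||w [wA qwq xw]] := qdiv 0 (y *m x).
- by rewrite -[0]addr0 mulA.
- by [].
- by rewrite !mulmxA qy -mulmxA xq.
have yxyx : y *m x *m (y *m x) = y *m x by rewrite !mulmxA -(mulmxA y) xy yf.
have <- : y *m x *m q = y *m x by rewrite -mulmxA xq.
by rewrite -{1}xw mulmxA yxyx.
Qed.

Section GammaCorner.
Variables (F : fieldType) (G : zmodType) (m n l : nat) (gamma0 gamma1 : seq G).
Hypotheses (e0 : (size gamma0 * l = m)%N) (e1 : (size gamma1 * l = n)%N).
Variables (T : {fset G}) (D_ : G -> {vspace 'M[F]_l}).
Hypothesis DT : forall t, (t \in T) = (D_ t != 0%VS).
Hypothesis divD : division_grading (@mulmx F _ _ _) 1%:M D_.
Hypothesis l_gt0 : (0 < l)%N.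
Let gamma := gamma0 ++ gamma1.
Let e := kron_dim e0 e1.

Lemma tunit_mem_Gamma i j t d : d \in D_ t ->
  tunit e i j d \in Gamma e0 e1 T D_ (gamma`_i + t - gamma`_j).
Proof.
move=> dt; apply/(mem_GammaP e0 e1 DT) => a b; rewrite tblock_tunit.
case: ifP => [/andP[/eqP-> /eqP->]|_]; last exact: mem0v.
by rewrite addrAC subrK [_ + t]addrC addrK.
Qed.

(** [G] being abelian, [g_i + t - g_i = t]: this corner is [D_] with unchanged degrees. *)
Lemma Gamma_division_corner i : division_corner (Gamma e0 e1 T D_) (tunit e i i 1%:M).
Proof.
have [gD _] := divD; have one0 : 1%:M != 0 :> 'M[F]_l.
  apply/matrix0Pn; exists (Ordinal l_gt0), (Ordinal l_gt0).
  by rewrite mxE eqxx oner_neq0.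
split.
- by rewrite -(subrr gamma`_i) -[X in X - _]addr0 tunit_mem_Gamma ?grading1.
- apply: contraNneq one0 => t0; apply/eqP; apply: (tunit_inj (e := e) (i := i) (j := i)).
  by rewrite t0 linear0.
- by rewrite tunitM eqxx mulmx1.
move=> g x /(mem_GammaP e0 e1 DT) xg x0; rewrite tunit_corner => xE.
have dg : tblock e i i x \in D_ g by rewrite -[g](subrK gamma`_i).
have d0 : tblock e i i x != 0.
  by apply: contraNneq x0 => d0; rewrite -xE d0 linear0.
have [z zg [xz _]] := division_inv divD dg d0.
exists (tunit e i i z); split.
- by rewrite -[- g](addrK gamma`_i) [- g + _]addrC tunit_mem_Gamma.
- by rewrite !tunitM eqxx tunitM eqxx mul1mx mulmx1.
- by rewrite -{1}xE tunitM eqxx xz.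
Qed.

End GammaCorner.

(** * Homogeneous parts of block columns *)

Section GammaLines.
Variables (F : closedFieldType) (G : zmodType) (m n l : nat) (gamma0 gamma1 : seq G).
Hypotheses (e0 : (size gamma0 * l = m)%N) (e1 : (size gamma1 * l = n)%N).
Variables (T : {fset G}) (D_ : G -> {vspace 'M[F]_l}).
Hypothesis DT : forall t, (t \in T) = (D_ t != 0%VS).
Hypothesis divD : division_grading (@mulmx F _ _ _) 1%:M D_.
Let gamma := gamma0 ++ gamma1.
Let e := kron_dim e0 e1.
Variables (p : nat) (iota : 'I_p -> 'I_(size gamma0 + size gamma1)).
Hypothesis iota_inj : injective iota.
Variable j : 'I_(size gamma0 + size gamma1).

(** The part of degree [g] of block column [j], restricted to the rows in the image of [iota]. Its
    dimension counts the [i] for which [gamma_(iota i)] lies in the coset of [g + gamma_j], so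
    letting [g] vary recovers a multiset of cosets. *)
Definition Gamma_line (g : G) : {vspace 'M[F]_(m + n)} :=
  (\sum_(i < p) linfun (tunit e (iota i) j) @: D_ (g - gamma`_(iota i) + gamma`_j)%R)%VS.

Lemma dim_Gamma_line g : \dim (Gamma_line g) =
  (\sum_(i < p) ((g - gamma`_(iota i) + gamma`_j)%R \in T))%N.
Proof.
transitivity (\sum_(i < p) \dim (linfun (tunit e (iota i) j)
    @: D_ (g - gamma`_(iota i) + gamma`_j)))%N.
  apply/directvP/directv_sum_independent => u uD u0 i _.
  have [d _ ud] := memv_imgP (uD i isT); rewrite ud lfunE.
  have := congr1 (tblock e (iota i) j) u0; rewrite linear_sum linear0 (bigD1 i) //=.
  rewrite big1 => [|i' i'i].
    by rewrite addr0 ud !lfunE /= tblock_tunit !eqxx => /= ->; rewrite linear0.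
  have [d' _ ->] := memv_imgP (uD i' isT); rewrite lfunE /= tblock_tunit.
  by rewrite (inj_eq iota_inj) eq_sym (negPf i'i).
apply: eq_bigr => i _; rewrite DT -division_dim // limg_dim_eq //.
apply/eqP; rewrite -subv0; apply/subvP => d /memv_capP[_].
rewrite memv_ker lfunE -(linear0 (tunit e (iota i) j)) => /eqP/tunit_inj->.
exact: mem0v.
Qed.

(** A description by a degree and two idempotents, which an isomorphism can transport without
    reference to blocks. *)
Lemma mem_Gamma_line g z : z \in Gamma_line g <->
  [/\ z \in Gamma e0 e1 T D_ g,
      (\sum_i tunit e (iota i) (iota i) 1%:M) *m z = z
    & z *m tunit e j j 1%:M = z].
Proof.
split=> [/memv_sumP[u uD ->]|[zg ez zq]].
  have uE i : exists2 d, d \in D_ (g - gamma`_(iota i) + gamma`_j)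
      & u i = tunit e (iota i) j d.
    by have [d dg ->] := memv_imgP (uD i isT); exists d; rewrite // lfunE.
  split.
  - apply: memv_suml => i _; have [d dg ->] := uE i.
    have := tunit_mem_Gamma e0 e1 DT (iota i) j dg.
    by rewrite addrA addrK addrC subrK.
  - rewrite mulmx_sumr; apply: eq_bigr => i _; have [d dg ->] := uE i.
    rewrite mulmx_suml (bigD1 i) //= big1 ?addr0 => [|i' i'i].
      by rewrite tunitM eqxx mul1mx.
    by rewrite tunitM (inj_eq iota_inj) (negPf i'i).
  - rewrite mulmx_suml; apply: eq_bigr => i _; have [d dg ->] := uE i.
    by rewrite tunitM eqxx mulmx1.
rewrite -zq -ez !mulmx_suml; apply: memv_suml => i _; rewrite tunit_corner.
apply: (subvP (sumv_sup i _ (subvv _))) => //.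
rewrite -[tunit e _ _ _](lfunE (tunit e (iota i) j)) memv_img //.
by apply: (mem_GammaP e0 e1 DT g z).1.
Qed.

End GammaLines.

Lemma division_corner_img (F : fieldType) (G : zmodType) (N : nat)
    (A_ B_ : G -> {vspace 'M[F]_N}) (phi : 'End('M[F]_N)) (q : 'M[F]_N) :
    injective phi -> (forall x y, phi (x *m y) = phi x *m phi y) ->
    (forall g, (phi @: A_ g)%VS = B_ g) ->
  division_corner A_ q -> division_corner B_ (phi q).
Proof.
move=> phi_inj phiM phiA [q0A q0 qq qdiv]; split.
- by rewrite -phiA memv_img.
- by rewrite -(linear0 phi) (inj_eq phi_inj).
- by rewrite -phiM qq.
move=> g _ /[1!(esym (phiA g))]/memv_imgP[x xg ->].
rewrite -!phiM -{1}(linear0 phi) (inj_eq phi_inj) => x0 /phi_inj qxq.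
have [z [zg qzq xz]] := qdiv g x xg x0 qxq; exists (phi z).
by rewrite -!phiM qzq xz -phiA memv_img.
Qed.

(** * Transport of corners along an isomorphism *)

Section GammaInvariants.
Variables (F : closedFieldType) (G : zmodType) (m n l l' : nat) (T T' : {fset G}).
Variables (beta beta' : G -> G -> F).
Variables (D_ : G -> {vspace 'M[F]_l}) (D'_ : G -> {vspace 'M[F]_l'}).
Variables (gamma0 gamma1 gamma0' gamma1' : seq G).
Hypotheses (e0 : (size gamma0 * l = m)%N) (e1 : (size gamma1 * l = n)%N).
Hypotheses (e0' : (size gamma0' * l' = m)%N) (e1' : (size gamma1' * l' = n)%N).
Hypotheses (dataD : division_data T beta D_) (dataD' : division_data T' beta' D'_).
Let gamma := gamma0 ++ gamma1.
Let gamma' := gamma0' ++ gamma1'.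
Let e := kron_dim e0 e1.
Let e' := kron_dim e0' e1'.
Variable phi : 'End('M[F]_(m + n)).
Hypothesis phi_auto : super_automorphism phi.
Hypothesis phiG :
  forall g, (phi @: Gamma e0 e1 T D_ g)%VS = Gamma e0' e1' T' D'_ g.

Let l_gt0 : (0 < l)%N := division_data_size_gt0 dataD.
Let l'_gt0 : (0 < l')%N := division_data_size_gt0 dataD'.

(** The idempotents [E_jj (x) 1] sum to 1, so one of them has a nonzero product with the image of
    [E_ii (x) 1]; the two division corners are then linked. *)
Lemma Gamma_corner_equiv i : exists j x y,
  [/\ x \in Gamma e0' e1' T' D'_ 0, y \in Gamma e0' e1' T' D'_ 0,
      tunit e' j j 1%:M *m x = x, y *m tunit e' j j 1%:M = y
    & x *m y = tunit e' j j 1%:M /\ y *m x = phi (tunit e i i 1%:M)].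
Proof.
have [phi_bij _ phiM _] := phi_auto; have phi_inj := bij_inj phi_bij.
have [_ _ [_ div DT _]] := dataD; have [_ _ [_ div' DT' _]] := dataD'.
have cq := division_corner_img phi_inj phiM phiG
  (Gamma_division_corner e0 e1 DT div l_gt0 i).
have [j fq] : exists j, tunit e' j j 1%:M *m phi (tunit e i i 1%:M) != 0.
  apply/existsP; apply: contraT => /existsPn fq; have [_ q0 _ _] := cq.
  case/negP: q0; apply/eqP.
  rewrite -[phi _]mul1mx -(munit1 (tunit_matrix_units F e')) mulmx_suml big1 // => j _.
  by have := fq j; rewrite negbK lfunE => /eqP.
have [x [y xy]] := division_corner_equiv
  (Gamma_grading e0' e1' DT' div'.1) cq
  (Gamma_division_corner e0' e1' DT' div' l'_gt0 j) fq.
by exists j, x, y.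
Qed.

Section Corner.
Variables (i : 'I_(size gamma0 + size gamma1)).
Variables (j : 'I_(size gamma0' + size gamma1')) (x y : 'M[F]_(m + n)).
Let q := phi (tunit e i i 1%:M).
Let f := tunit e' j j 1%:M : 'M[F]_(m + n).
Hypotheses (xG : x \in Gamma e0' e1' T' D'_ 0) (yG : y \in Gamma e0' e1' T' D'_ 0).
Hypotheses (fx : f *m x = x) (yf : y *m f = y) (xy : x *m y = f) (yx : y *m x = q).

(** The composite of [D] with the corner at [i], then [phi], then the passage from the corner of [q]
    to that of [f] given by [x] and [y], then the identification of the latter with [D']. Degrees
    are kept because [x] and [y] have degree 0. *)
Definition corner_map d := tblock e' j j (x *m phi (tunit e i i d) *m y).

Lemma corner_degree t d : d \in D_ t -> corner_map d \in D'_ t.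
Proof.
have [_ _ [_ div DT _]] := dataD; have [_ _ [_ [gD' _] DT' _]] := dataD'.
have [_ mulG'] := Gamma_grading e0' e1' DT' gD'.
move=> dt; have phid : phi (tunit e i i d) \in Gamma e0' e1' T' D'_ t.
  rewrite -phiG memv_img // -[t in Gamma _ _ _ _ t](addrK gamma`_i).
  by rewrite [t + _]addrC tunit_mem_Gamma.
have := mulG' _ _ _ _ (mulG' _ _ _ _ xG phid) yG; rewrite add0r addr0.
by move/(mem_GammaP e0' e1' DT')/(_ j j); rewrite subrK.
Qed.

Lemma tunit_corner_map d : tunit e' j j (corner_map d) = x *m phi (tunit e i i d) *m y.
Proof. by rewrite -tunit_corner -/f !mulmxA fx -!mulmxA yf. Qed.

Lemma corner_mul d d' : corner_map (d *m d') = corner_map d *m corner_map d'.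
Proof.
have [_ _ phiM _] := phi_auto.
apply: (tunit_inj (e := e') (i := j) (j := j)).
have <- : tunit e' j j (corner_map d) *m tunit e' j j (corner_map d')
        = tunit e' j j (corner_map d *m corner_map d') by rewrite tunitM eqxx.
rewrite !tunit_corner_map.
have -> : tunit e i i (d *m d')
        = tunit e i i d *m tunit e i i 1%:M *m tunit e i i d'.
  by rewrite !tunitM eqxx tunitM eqxx mulmx1.
by rewrite !phiM -/q -yx !mulmxA.
Qed.

Lemma corner_scale c d : corner_map (c *: d) = c *: corner_map d.
Proof. by rewrite /corner_map !linearZ /= -scalemxAl linearZ. Qed.

Lemma corner_neq0 d : d != 0 -> corner_map d != 0.
Proof.
have [phi_bij _ phiM _] := phi_auto.
apply: contraNneq => d0; apply/eqP; apply: (tunit_inj (e := e) (i := i) (j := i)).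
apply: (bij_inj phi_bij); rewrite !linear0.
have -> : tunit e i i d = tunit e i i 1%:M *m tunit e i i d *m tunit e i i 1%:M.
  by rewrite !tunitM eqxx tunitM eqxx mulmx1 mul1mx.
rewrite !phiM -/q -yx.
have -> : y *m x *m phi (tunit e i i d) *m (y *m x)
        = y *m (x *m phi (tunit e i i d) *m y) *m x by rewrite !mulmxA.
by rewrite -tunit_corner_map d0 linear0 mulmx0 mul0mx.
Qed.

(* Right multiplication by [y] identifies [phi (A_g e_i)] with [A'_g f_j]. *)
Lemma dim_Gamma_line_eq p p' (iota : 'I_p -> 'I_(size gamma0 + size gamma1))
    (iota' : 'I_p' -> 'I_(size gamma0' + size gamma1')) g :
    injective iota -> injective iota' ->
    phi (\sum_a tunit e (iota a) (iota a) 1%:M)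
      = \sum_a tunit e' (iota' a) (iota' a) 1%:M ->
  (\sum_a ((g - gamma`_(iota a) + gamma`_i)%R \in T))%N
    = (\sum_a ((g - gamma'`_(iota' a) + gamma'`_j)%R \in T'))%N.
Proof.
have [phi_bij _ phiM _] := phi_auto.
have [_ _ [_ div DT _]] := dataD; have [_ _ [_ div' DT' _]] := dataD'.
have [_ mulG'] := Gamma_grading e0' e1' DT' div'.1.
move=> iota_inj iota'_inj phi_eps.
rewrite -(dim_Gamma_line e0 e1 DT div iota_inj).
rewrite -(dim_Gamma_line e0' e1' DT' div' iota'_inj).
pose h : 'End('M[F]_(m + n)) := linfun (mulmxr y \o phi).
have hE z : h z = phi z *m y by rewrite lfunE.
have phiq z : phi z *m q = phi (z *m tunit e i i 1%:M) by rewrite phiM.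
set L := Gamma_line _ _ _ _ _ g; set L' := Gamma_line _ _ _ _ _ g.
have LP z : z \in L <-> _ := mem_Gamma_line e0 e1 DT iota_inj i g z.
have LP' z : z \in L' <-> _ := mem_Gamma_line e0' e1' DT' iota'_inj j g z.
have <- : (h @: L = L')%VS.
  apply/eqP; rewrite eqEsubv; apply/andP; split; apply/subvP.
    move=> _ /memv_imgP[z /LP[zg ez zq] ->]; apply/LP'; rewrite hE; split.
    - by rewrite -[g]addr0 mulG' // -phiG memv_img.
    - by rewrite -phi_eps mulmxA -phiM ez.
    - by rewrite -mulmxA yf.
  move=> w /LP'[wg ew wf].
  have wxg : w *m x \in Gamma e0' e1' T' D'_ g by rewrite -[g]addr0 mulG'.
  move: wxg; rewrite -phiG => /memv_imgP[z zg wx].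
  have zL : z \in L.
    apply/LP; split=> //; apply: (bij_inj phi_bij).
      by rewrite phiM phi_eps -wx mulmxA ew.
    by rewrite -phiq -wx -yx mulmxA -[w *m x *m y]mulmxA xy wf.
  apply/memv_imgP; exists z => //.
  by rewrite hE -wx -mulmxA xy wf.
rewrite limg_dim_eq //; apply/eqP; rewrite -subv0; apply/subvP => z.
move=> /memv_capP[/LP[_ _ zq]]; rewrite memv_ker hE memv0 => /eqP zy.
rewrite -(inj_eq (bij_inj phi_bij)) linear0 -zq -phiq -yx mulmxA zy mul0mx //.
Qed.

End Corner.

(** [corner_map] respects degrees and products and kills no nonzero element, so the support of [D_]
    lies in that of [D'_], and the commutation factors read off from products agree. *)
Lemma Gamma_iso_support : (0 < m + n)%N ->
  {subset T <= T'} /\ {in T &, forall u v, beta u v = beta' u v}.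
Proof.
move=> N_gt0; have i : 'I_(size gamma0 + size gamma1).
  exists 0%N; rewrite lt0n; apply: contraTneq N_gt0 => k0.
  by rewrite -(kron_dim e0 e1) k0.
have [j [x [y [xG yG fx yf [xy yx]]]]] := Gamma_corner_equiv i.
have deg := corner_degree i j xG yG; have delM := corner_mul fx yf yx.
have delZ := corner_scale i j x y; have del0 := corner_neq0 fx yf yx.
have [_ _ [_ div DT Dc]] := dataD; have [sT' _ [_ div' DT' Dc']] := dataD'.
have pick_neq0 t : t \in T -> vpick (D_ t) != 0 by rewrite DT vpick0.
have sub : {subset T <= T'}.
  move=> t /pick_neq0/del0; rewrite DT'; apply: contraNneq => D't.
  by rewrite -memv0 -D't; apply: deg; apply: memv_pick.
split=> // u v uT vT.
set X := vpick (D_ u); set Y := vpick (D_ v).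
have XY : X *m Y = beta u v *: (Y *m X) by apply: Dc; rewrite ?memv_pick.
have YX0 : Y *m X != 0.
  have [X' _ [XX' _]] := division_inv div (memv_pick _) (pick_neq0 u uT).
  apply: contraNneq (pick_neq0 v vT) => YX.
  by rewrite -/Y -[Y]mulmx1 -XX' mulmxA YX mul0mx.
have := Dc' u v (sub u uT) (sub v vT) _ _ (deg _ _ (memv_pick _)) (deg _ _ (memv_pick _)).
rewrite -!delM -/X -/Y XY delZ => /eqP.
rewrite -subr_eq0 -scalerBl scaler_eq0 (negPf (del0 _ YX0)) orbF subr_eq0.
by move/eqP.
Qed.

End GammaInvariants.

(** * Recovering the multisets of cosets *)

Lemma count_nth (G : zmodType) (P : pred G) (s : seq G) :
  count P s = (\sum_(i < size s) P (nth 0%R s i))%N.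
Proof.
rewrite -sum1_count (big_nth 0) big_mkord big_mkcond.
by apply: eq_bigr => i _; case: (P _).
Qed.

(** The condition [g - a + c \in T] says that [a] lies in the coset of [g + c]; the counts are
    therefore multiplicities of cosets, displaced by [c] on one side and by [c'] on the other. *)
Lemma Xi_eq_of_count (G : zmodType) (T : {fset G}) (c c' : G) (s s' : seq G) :
    subgroup T ->
    (forall g, count (fun a => g - a + c \in T) s
             = count (fun a => g - a + c' \in T) s') ->
  act_mset (c' - c) (Xi T s) = Xi T s'.
Proof.
move=> sT ss'; apply/act_mset_XiP; apply/allP => C CX.
have [c0 {CX}->] : exists c0, C = translate c0 T.
  by move: CX; rewrite mem_cat => /orP[] /mapP[a _ ->]; eexists.
have trE a b : (translate a T == translate b T) = (b - a \in T).
  by apply/eqP/idP => /(translate_eqP sT).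
(* The choice [g = c0 - c'] makes the right-hand count the multiplicity of the coset of [c0]. *)
rewrite /= !count_map; apply/eqP; have := ss' (c0 - c').
rewrite (@eq_count _ _ (preim (fun a => translate (c' - c + a) T)
                              (pred1 (translate c0 T)))) => [->|a /=]; last first.
  by rewrite trE opprD opprB -!addrA [- a + c]addrC [- c' + (c + _)]addrCA.
apply: eq_count => a /=.
by rewrite trE addrAC subrK.
Qed.

Section XiOfIso.
Variables (F : closedFieldType) (G : zmodType) (m n l : nat) (T : {fset G}).
Variables (beta beta' : G -> G -> F) (D_ D'_ : G -> {vspace 'M[F]_l}).
Variables (gamma0 gamma1 gamma0' gamma1' : seq G).
Hypotheses (e0 : (size gamma0 * l = m)%N) (e1 : (size gamma1 * l = n)%N).
Hypotheses (e0' : (size gamma0' * l = m)%N) (e1' : (size gamma1' * l = n)%N).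
Hypotheses (dataD : division_data T beta D_) (dataD' : division_data T beta' D'_).

(** The shift is [c' - c] for one linked pair [(i, j)]. The same pair measures the rows of both
    parities, so a single [g] serves both tuples; whether [phi] fixes [parity_mx] or sends it to its
    complement decides the alternative. *)
Lemma Xi_of_Gamma_iso : (0 < m)%N -> (0 < n)%N ->
    grading_iso (Gamma e0 e1 T D_) (Gamma e0' e1' T D'_) ->
  exists g,
    (act_mset g (Xi T gamma0) = Xi T gamma0' /\
     act_mset g (Xi T gamma1) = Xi T gamma1') \/
    (act_mset g (Xi T gamma0) = Xi T gamma1' /\
     act_mset g (Xi T gamma1) = Xi T gamma0').
Proof.
move=> m_gt0 n_gt0 [phi [phi_auto phiG]]; have [sT _ _] := dataD.
have i : 'I_(size gamma0 + size gamma1).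
  exists 0%N; rewrite addn_gt0; apply/orP; left.
  by rewrite lt0n; apply: contraTneq m_gt0 => k0; rewrite -e0 k0.
have [j [x [y [xG yG fx yf [xy yx]]]]] :=
  Gamma_corner_equiv dataD dataD' phi_auto phiG i.
pose c := (gamma0 ++ gamma1)`_i; pose c' := (gamma0' ++ gamma1')`_j.
exists (c' - c).
have XiE p p' (iota : 'I_(size p) -> 'I_(size gamma0 + size gamma1))
    (iota' : 'I_(size p') -> 'I_(size gamma0' + size gamma1')) :
    injective iota -> injective iota' ->
    (forall a, (gamma0 ++ gamma1)`_(iota a) = p`_a) ->
    (forall a, (gamma0' ++ gamma1')`_(iota' a) = p'`_a) ->
    phi (\sum_a tunit (kron_dim e0 e1) (iota a) (iota a) 1%:M)
      = \sum_a tunit (kron_dim e0' e1') (iota' a) (iota' a) 1%:M ->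
  act_mset (c' - c) (Xi T p) = Xi T p'.
  move=> iota_inj iota'_inj ip ip' phi_eps; apply: Xi_eq_of_count => // g.
  have := dim_Gamma_line_eq dataD dataD' phi_auto phiG xG yG yf xy yx g
    iota_inj iota'_inj phi_eps.
  rewrite !count_nth /=; under eq_bigr do rewrite ip.
  by under [RHS]eq_bigr do rewrite ip'.
have [_ phi1 _ _] := phi_auto.
have XiLL := XiE gamma0 gamma0' (lshift _) (lshift _).
have XiRR := XiE gamma1 gamma1' (@rshift _ _) (@rshift _ _).
have XiLR := XiE gamma0 gamma1' (lshift _) (@rshift _ _).
have XiRL := XiE gamma1 gamma0' (@rshift _ _) (lshift _).
have nthl (s0 s1 : seq G) a := nth_cat_lshift s1 (s0 := s0) a.
have nthr (s0 s1 : seq G) a := nth_cat_rshift s0 (s1 := s1) a.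
move: XiLL XiRR XiLR XiRL; rewrite -!parity_mx_tunit -!parity_mx_tunit_r.
move=> XiLL XiRR XiLR XiRL.
have phi_r : phi (1%:M - parity_mx F m n) = 1%:M - phi (parity_mx F m n).
  by rewrite linearB /= phi1.
by case: (super_automorphism_parity m_gt0 n_gt0 phi_auto) => phip; [left|right]; split;
  [apply: XiLL | apply: XiRR | apply: XiLR | apply: XiRL] => //;
  try exact: lshift_inj; try exact: rshift_inj; rewrite ?phi_r phip // opprB addrC subrK.
Qed.

End XiOfIso.

(** * Existence *)

Section DivisionData.
Variables (F : closedFieldType) (G : zmodType) (l : nat) (D_ : G -> {vspace 'M[F]_l}).
Hypothesis divD : division_grading (@mulmx F _ _ _) 1%:M D_.
Hypothesis l_gt0 : (0 < l)%N.

(** The coordinate of [X_u X_v] along [X_v X_u]; meaningful when both components are nonzero. *)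
Definition commutation_factor (u v : G) : F :=
  coord [tuple vpick (D_ v) *m vpick (D_ u)] ord0 (vpick (D_ u) *m vpick (D_ v)).

Lemma division_mul_neq0 u (x y : 'M[F]_l) :
  x \in D_ u -> x != 0 -> y != 0 -> x *m y != 0.
Proof.
move=> xu x0; have [z _ [_ zx]] := division_inv divD xu x0.
by apply: contraNneq => xy; rewrite -[y]mul1mx -zx -mulmxA xy mulmx0.
Qed.

Lemma commutation_factorE u v x y : D_ u != 0%VS -> D_ v != 0%VS ->
  x \in D_ u -> y \in D_ v -> x *m y = commutation_factor u v *: (y *m x).
Proof.
rewrite -!vpick0 => Xu0 Xv0; have [[_ mulD] _] := divD.
have Xu := memv_pick (D_ u); have Xv := memv_pick (D_ v).
rewrite (division_line divD Xu Xu0) (division_line divD Xv Xv0).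
move=> /vlineP[a ->] /vlineP[b ->].
have YX0 := division_mul_neq0 Xv Xv0 Xu0.
have XY : vpick (D_ u) *m vpick (D_ v) \in <<[tuple vpick (D_ v) *m vpick (D_ u)]>>%VS.
  rewrite span_seq1 -(division_line divD (mulD _ _ _ _ Xv Xu) YX0) addrC.
  exact: mulD.
rewrite -!scalemxAl -!scalemxAr [X in a *: (b *: X)](coord_span XY) big_ord1.
by rewrite !scalerA /= -/(commutation_factor u v) mulrC [a * b]mulrC mulrA.
Qed.

Lemma scalemx_inj (a b : F) (x : 'M[F]_l) : x != 0 -> a *: x = b *: x -> a = b.
Proof.
move=> x0 /eqP; rewrite -subr_eq0 -scalerBl scaler_eq0 (negPf x0) orbF subr_eq0.
by move/eqP.
Qed.

(** Products and inverses of nonzero homogeneous elements are nonzero, so the support is a subgroup;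
    the bicharacter identities come from commuting a product past a third element in two ways and
    comparing coefficients. *)
Lemma division_grading_data : exists T beta, division_data T beta D_.
Proof.
have [gD _] := divD; have [decD mulD] := gD; have [dirD _] := decD.
have [s [pr P]] := decomposition_proj decD.
pose T := [fset t in s | D_ t != 0%VS].
have DT t : (t \in T) = (D_ t != 0%VS).
  rewrite !inE /= -vpick0; have [//|ts] := boolP (t \in s).
  have := projE P t (memv_pick (D_ t)).
  by rewrite eqxx (proj_supp _ P ts) => <-; rewrite eqxx.
pose X t := vpick (D_ t).
have XD t : X t \in D_ t by apply: memv_pick.
have X0 t : t \in T -> X t != 0 by rewrite DT vpick0.
have one0 : 1%:M != 0 :> 'M[F]_l.
  apply/matrix0Pn; exists (Ordinal l_gt0), (Ordinal l_gt0).
  by rewrite mxE eqxx oner_neq0.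
have memT t (x : 'M[F]_l) : x \in D_ t -> x != 0 -> t \in T.
  by rewrite DT => xt; apply: contraNneq => D0; rewrite -memv0 -D0.
have sT : subgroup T.
  split=> [|u v uT vT]; first by apply: memT one0; apply: grading1.
  have [y yv [xy _]] := division_inv divD (XD v) (X0 v vT).
  apply: (memT _ (X u *m y)); first exact: mulD.
  apply: division_mul_neq0 (XD u) (X0 u uT) _.
  by apply: contraNneq one0 => y0; rewrite -xy y0 mulmx0.
have Xcomm u v x y : u \in T -> v \in T -> x \in D_ u -> y \in D_ v ->
    x *m y = commutation_factor u v *: (y *m x).
  by rewrite !DT; apply: commutation_factorE.
have Xc u v (uT : u \in T) (vT : v \in T) := Xcomm u v _ _ uT vT (XD u) (XD v).
have XX0 u v : u \in T -> v \in T -> X u *m X v != 0.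
  by move=> uT vT; apply: division_mul_neq0 (XD u) (X0 u uT) (X0 v vT).
exists T, commutation_factor; split=> //.
- split.
  + move=> u v uT vT; apply: contraNneq (XX0 u v uT vT) => b0.
    by rewrite Xc // b0 scale0r.
  + move=> u v w uT vT wT.
    apply: (@scalemx_inj _ _ (X w *m (X u *m X v))).
      exact: division_mul_neq0 (XD w) (X0 w wT) (XX0 u v uT vT).
    rewrite -(Xcomm (u + v) w) ?(subgroup_add sT) //; last exact: mulD.
    by rewrite -mulmxA (Xc v w) // -scalemxAr (mulmxA (X u)) (Xc u w) // -scalemxAl
      scalerA mulrC -mulmxA.
  + move=> u v w uT vT wT.
    apply: (@scalemx_inj _ _ (X v *m X w *m X u)).
      by apply: division_mul_neq0 (mulD _ _ _ _ (XD v) (XD w)) (XX0 v w vT wT) (X0 u uT).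
    rewrite -(Xcomm u (v + w)) ?(subgroup_add sT) //; last exact: mulD.
    by rewrite mulmxA (Xc u v) // -scalemxAl -mulmxA (Xc u w) // -scalemxAr
      scalerA mulmxA.
  + move=> t tT; apply: (scalemx_inj (XX0 t t tT tT)).
    by rewrite -Xc // scale1r.
  (* Nondegeneracy: [X t] commutes with all homogeneous elements, so it is central, hence scalar,
     hence of degree 0, which contradicts [t0]. *)
  move=> t tT tcomm; apply/eqP; apply: contraT => t0.
  have [c XE] : exists c, X t = c%:M.
    apply: mx_comm_scalar => x; rewrite [x](proj_sum P) mulmx_sumr mulmx_suml.
    apply: eq_bigr => u _; have [uT|uT] := boolP (u \in T).
      by rewrite (Xcomm t u _ _ tT uT (XD t) (projD P u x)) tcomm // scale1r.
    have -> : pr u x = 0; last by rewrite mulmx0 mul0mx.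
    by apply: contraNeq uT => p0; apply: memT p0; apply: (projD P).
  have Xt0 : X t \in D_ 0 by rewrite XE -scalemx1 memvZ // grading1.
  have := projE P t Xt0; rewrite (negPf t0) (projE P t (XD t)) eqxx => Xt.
  by rewrite -(negPf (X0 t tT)) Xt eqxx.
split=> //; last by move=> u v uT vT x y; apply: Xcomm.
(* The components over [T] are lines, so the dimension [l * l] of the direct sum is the number of
   elements of [T]. *)
have full : fullv = (\sum_(t <- T) D_ t)%VS.
  apply/esym/eqP; rewrite eqEsubv subvf; apply/subvP => x _.
  rewrite [x](proj_sum P); apply: memv_suml => t _.
  have [-> |x0] := eqVneq (pr t x) 0; first exact: mem0v.
  apply: (subvP (subv_sum_seq D_ (memT _ _ (projD P t x) x0))).
  exact: (projD P).
have := congr1 (fun W : {vspace 'M[F]_l} => \dim W) full.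
have /directvP/= -> := dirD T (fset_uniq T).
rewrite dimvf dim_matrix big_seq (eq_bigr (fun=> 1%N)) => [|t tT].
  by rewrite -big_seq sum1_size -mulnn.
by rewrite division_dim // -DT tT.
Qed.

End DivisionData.

(** * Coordinates in a homogeneous basis of a graded module *)

Section GradedModule.
Variables (F : fieldType) (H : zmodType) (D : falgType F) (D_ : H -> {vspace D}).
Variables (U : vectType F) (act : U -> D -> U) (U_ : H -> {vspace U}).
Hypotheses (decD : decomposition D_) (modU : graded_right_module D_ act U_).
Variables (k : nat) (b : 'I_k -> U) (h : 'I_k -> H).
Hypothesis b_deg : forall i, b i \in U_ (h i).
Hypothesis b_basis : forall u, exists! d : {ffun 'I_k -> D}, u = \sum_i act (b i) (d i).

Let comb (d : {ffun 'I_k -> D}) : U := \sum_i act (b i) (d i).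

Let act_suml (u : 'I_k -> U) d : act (\sum_i u i) d = \sum_i act (u i) d.
Proof.
have lin := ract_linear_l modU d.
have := linear_sum (linfun (act^~ d)) (index_enum _) xpredT u; rewrite /= linfun_linear // => ->; apply: eq_bigr => i _; exact: linfun_linear.
Qed.

Let act_sumr (I : Type) (r : seq I) u (d : I -> D) :
  act u (\sum_(i <- r) d i) = \sum_(i <- r) act u (d i).
Proof.
have lin := ract_linear_r modU u.
have := linear_sum (linfun (act u)) r xpredT d; rewrite /= linfun_linear // => ->; apply: eq_bigr => i _; exact: linfun_linear.
Qed.

Let act0 u : act u 0 = 0.
Proof.
by have := linear0 (linfun (act u)); rewrite /= linfun_linear //; apply: ract_linear_r modU u.
Qed.

Let comb_linear : linear comb.
Proof.
move=> c d d'; rewrite /comb scaler_sumr -big_split; apply: eq_bigr => i _ /=.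
by rewrite !ffunE (ract_linear_r modU).
Qed.

Let comb_ker : lker (linfun comb) == 0%VS.
Proof.
apply/lker0P => d d'; rewrite !linfun_linear // => dd'.
by have [d0 [_ d0u]] := b_basis (comb d); rewrite -(d0u d) // -(d0u d').
Qed.

(** Inverting the linear map [comb], rather than choosing from [b_basis], makes the coordinates
    linear at once. *)
Definition coordinate (u : U) (i : 'I_k) : D := (linfun comb)^-1%VF u i.

Lemma coordinate_comb d i : coordinate (\sum_i act (b i) (d i)) i = d i.
Proof.
have -> : \sum_i act (b i) (d i) = linfun comb [ffun i => d i].
  by rewrite linfun_linear //; apply: eq_bigr => j _; rewrite ffunE.
by rewrite /coordinate lker0_lfunK // ffunE.
Qed.

Lemma coordinateE u : u = \sum_i act (b i) (coordinate u i).
Proof.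
have [d [ud _]] := b_basis u; rewrite {1}ud; apply: eq_bigr => i _.
by rewrite ud coordinate_comb.
Qed.

Lemma coordinate_linear i : linear (coordinate^~ i).
Proof. by move=> c u v; rewrite /coordinate linearP !ffunE. Qed.

Lemma coordinate_act u d i : coordinate (act u d) i = coordinate u i * d.
Proof.
rewrite {1}[u]coordinateE act_suml.
under eq_bigr do rewrite -(ractM modU).
by rewrite coordinate_comb.
Qed.

Lemma coordinate_act_basis j d i : coordinate (act (b j) d) i = if i == j then d else 0.
Proof.
have -> : act (b j) d = \sum_i act (b i) (if i == j then d else 0).
  rewrite (bigD1 j) //= eqxx big1 ?addr0 // => i' /negPf->; exact: act0.
by rewrite coordinate_comb.
Qed.

(** Projecting [b_j d] to degree [s] amounts to projecting [d] to degree [s - h j]; since [u] equals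
    its own component, uniqueness of coordinates concludes. *)
Lemma coordinate_degree s u i : u \in U_ s -> coordinate u i \in D_ (s - h i).
Proof.
move=> us; have [r [pr P]] := decomposition_proj decD.
have [rU [prU PU]] := decomposition_proj (ract_decomposition modU).
have pr_act j d : prU s (act (b j) d) = act (b j) (pr (s - h j) d).
  rewrite {1}[d](proj_sum P) act_sumr linear_sum {2}[d](proj_sum P) linear_sum act_sumr.
  apply: eq_bigr => t _ /=; have dt := projD P t d.
  rewrite (projE PU _ (ract_degree modU (b_deg j) dt)) (projE P _ dt).
  rewrite -subr_eq0 opprD addrA subr_eq0.
  by case: ifP => _ //; rewrite act0.
have := projE PU s us; rewrite eqxx {1}[u]coordinateE linear_sum /=.
under eq_bigr do rewrite pr_act.
by move=> <-; rewrite coordinate_comb (projD P).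
Qed.

(** Sends [b_j] to [b_i d] and the other basis vectors to 0. The factor [d] stands to the left of
    the coordinate, which makes the map commute with the right action of [D]. *)
Definition basis_unit i j d : 'End(U) := linfun (fun u => act (b i) (d * coordinate u j)).

Lemma basis_unitE i j d u : basis_unit i j d u = act (b i) (d * coordinate u j).
Proof.
rewrite linfun_linear // => c v w.
by rewrite coordinate_linear mulrDr -scalerAr (ract_linear_r modU).
Qed.

Lemma basis_unit_linear i j : linear (basis_unit i j).
Proof.
move=> c d d'; apply/lfunP => u; rewrite add_lfunE scale_lfunE !basis_unitE.
by rewrite mulrDl -scalerAl (ract_linear_r modU).
Qed.

Lemma basis_unit_endo i j d : endomorphism_over act (basis_unit i j d).
Proof. by move=> u e; rewrite !basis_unitE coordinate_act mulrA (ractM modU). Qed.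

Lemma basis_unit_comp i j i' j' d d' :
  (basis_unit i j d \o basis_unit i' j' d')%VF =
  if j == i' then basis_unit i j' (d * d') else 0.
Proof.
apply/lfunP => u; rewrite comp_lfunE !basis_unitE coordinate_act_basis.
by case: ifP => _; rewrite ?zero_lfunE ?mulr0 ?act0 // basis_unitE mulrA.
Qed.

Lemma basis_unit1 : \sum_i basis_unit i i 1 = \1%VF.
Proof.
apply/lfunP => u; rewrite sum_lfunE id_lfunE [RHS]coordinateE.
by apply: eq_bigr => i _; rewrite basis_unitE mul1r.
Qed.

Lemma basis_unit_corner f i j : endomorphism_over act f ->
  (basis_unit i i 1 \o f \o basis_unit j j 1)%VF
  = basis_unit i j (coordinate (f (b j)) i).
Proof.
move=> fD; apply/lfunP => u; rewrite !comp_lfunE !basis_unitE !mul1r.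
by rewrite fD coordinate_act.
Qed.

Lemma basis_unit_inj i j : injective (basis_unit i j).
Proof.
have bj : coordinate (b j) j = 1.
  by rewrite -[b j](ract1 modU) coordinate_act_basis eqxx.
move=> d d' /lfunP/(_ (b j)); rewrite !basis_unitE bj !mulr1.
move=> /(congr1 (coordinate^~ i)).
by rewrite !coordinate_act_basis eqxx.
Qed.

Lemma basis_unit_degree i j t d : d \in D_ t ->
    (forall g g' x y, x \in D_ g -> y \in D_ g' -> x * y \in D_ (g + g')) ->
  homogeneous_map U_ (h i + t - h j) (basis_unit i j d).
Proof.
move=> dt mulD s u us; rewrite basis_unitE.
have := ract_degree modU (b_deg i) (mulD _ _ _ _ dt (coordinate_degree j us)).
by rewrite addrA [s - _]addrC addrA.
Qed.

End GradedModule.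

(* The matrix units of [End_D(U)] attached to a homogeneous [D]-basis of [U]. *)
Record graded_units (F : fieldType) (H : zmodType) (D : falgType F)
    (D_ : H -> {vspace D}) (N k : nat) (A_ : H -> {vspace 'M[F]_N})
    (h : 'I_k -> H) (K : 'I_k -> 'I_k -> D -> 'M[F]_N) : Prop := {
  gunit_linear : forall i j, linear (K i j);
  gunitM : forall i j i' j' d d',
    K i j d *m K i' j' d' = if j == i' then K i j' (d * d') else 0;
  gunit1 : \sum_i K i i 1 = 1%:M;
  gunit_inj : forall i j, injective (K i j);
  gunit_corner : forall i j x, exists d, K i i 1 *m x *m K j j 1 = K i j d;
  gunit_degree : forall i j t d, d \in D_ t -> K i j d \in A_ (h i + t - h j) }.

Lemma graded_units_of_module (F : fieldType) (H : zmodType) (D : falgType F)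
    (D_ : H -> {vspace D}) (U : vectType F) (act : U -> D -> U)
    (U_ : H -> {vspace U}) (N : nat) (A_ : H -> {vspace 'M[F]_N}) :
    grading *%R D_ -> graded_right_module D_ act U_ -> finite_rank act U_ ->
    iso_to_End A_ act U_ ->
  exists k h (K : 'I_k -> 'I_k -> D -> 'M[F]_N), graded_units D_ A_ h K.
Proof.
move=> [decD mulD] modU [k [b [b_hom b_basis]]] [Phi [Phi_inj Phi1 PhiM PhiE Phi_deg]].
have [h b_deg] := fin_all_exists b_hom.
have ker0 : lker Phi == 0%VS by apply/lker0P.
pose E := basis_unit act b.
pose K i j d := Phi^-1%VF (E i j d).
have PhiK i j d : Phi (K i j d) = E i j d.
  rewrite /K; have [+ _] := PhiE (E i j d).
  by move=> /(_ (basis_unit_endo modU b_basis i j d))[x ->]; rewrite lker0_lfunK.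
exists k, h, K; split.
- by move=> i j c d d'; rewrite /K /E (basis_unit_linear modU) linearP.
- move=> i j i' j' d d'; apply: Phi_inj; rewrite PhiM !PhiK (basis_unit_comp modU b_basis).
  by case: ifP; rewrite ?linear0 // PhiK.
- apply: Phi_inj; rewrite Phi1 linear_sum -(basis_unit1 modU b_basis).
  by apply: eq_bigr => i _; rewrite /= PhiK.
- by move=> i j d d' /(congr1 Phi); rewrite !PhiK; apply: (basis_unit_inj modU b_basis).
- move=> i j x; have xE : endomorphism_over act (Phi x).
    by apply/PhiE; exists x.
  exists (coordinate act b (Phi x (b j)) i); apply: Phi_inj.
  by rewrite !PhiM !PhiK /E -(basis_unit_corner modU b_basis).
- move=> i j t d dt.
  have [+ _] := Phi_deg (h i + t - h j) (E i j d).
  case=> [|x xA Ex]; last by rewrite /K Ex lker0_lfunK.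
  split; first exact: (basis_unit_endo modU b_basis).
  exact: (basis_unit_degree decD modU b_deg b_basis).
Qed.

(* The idempotent [K i0 i0 1] of rank [l], factored as [C R] with
   [R C = 1], carries [D] isomorphically onto ['M_l] by [d |-> R (K i0 i0 d) C]. *)
Lemma matrix_model (F : fieldType) (G : zmodType) (D : falgType F)
    (D_ : (G * 'Z_2)%type -> {vspace D}) (N k : nat)
    (A_ : (G * 'Z_2)%type -> {vspace 'M[F]_N}) (h : 'I_k -> (G * 'Z_2)%type)
    (K : 'I_k -> 'I_k -> D -> 'M[F]_N) :
    (0 < N)%N -> division_grading *%R 1 D_ ->
    supported_in D_ (fun gp => gp.2 == 0) -> graded_units D_ A_ h K ->
  exists l (D'_ : G -> {vspace 'M[F]_l}) (K' : 'I_k -> 'I_k -> 'Hom('M[F]_l, 'M[F]_N)),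
    [/\ (0 < l)%N, division_grading (@mulmx F _ _ _) 1%:M D'_, matrix_units K',
        forall i j t d, d \in D'_ t -> K' i j d \in A_ (h i + (t, 0) - h j)
      & (forall i j x, exists d, K' i i 1%:M *m x *m K' j j 1%:M = K' i j d) /\
        (forall i, \rank (K' i i 1%:M) <= l)%N].
Proof.
move=> N_gt0 [[decD mulD] invD] suppD [Klin KM K1 Kinj Kcorner Kdeg].
have one0 : 1%:M != 0 :> 'M[F]_N.
  apply/matrix0Pn; exists (Ordinal N_gt0), (Ordinal N_gt0).
  by rewrite mxE eqxx oner_neq0.
have i0 : 'I_k.
  case: k h K Klin KM K1 Kinj Kcorner Kdeg => [|k] h K Klin KM K1 *; last exact: ord0.
  by move: one0; rewrite -K1 big_ord0 eqxx.
pose q := K i0 i0 1; pose l := \rank q.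
pose C : 'M[F]_(N, l) := col_base q; pose R : 'M[F]_(l, N) := row_base q.
have qq : q *m q = q by rewrite /q KM eqxx mulr1.
have CR : C *m R = q by apply: mulmx_base.
(* Idempotence reads [C R C R = C R]; cancel the full-rank factors on both sides. *)
have RC : R *m C = 1%:M.
  apply: (row_full_inj (col_base_full q)); apply: (row_free_inj (row_base_free q)).
  by rewrite -/C -/R mulmx1 (mulmxA C R C) -(mulmxA (C *m R)) CR qq.
clearbody C R.
have qKq d : q *m K i0 i0 d *m q = K i0 i0 d.
  by rewrite /q !KM eqxx KM eqxx mul1r mulr1.
pose rho d := R *m K i0 i0 d *m C.
have rho_lin : linear rho.
  by move=> c d d'; rewrite /rho Klin mulmxDr mulmxDl -scalemxAr -scalemxAl.
have rhoK d : C *m rho d *m R = K i0 i0 d.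
  by rewrite /rho !mulmxA CR -mulmxA CR qKq.
have rho_inj : injective rho.
  by move=> d d' dd'; apply: (Kinj i0 i0); rewrite -rhoK dd' rhoK.
have rhoM d d' : rho (d * d') = rho d *m rho d'.
  transitivity (R *m (K i0 i0 d *m q *m K i0 i0 d') *m C).
    by rewrite /q !KM eqxx KM eqxx mulr1.
  by rewrite -CR /rho !mulmxA.
have rho1 : rho 1 = 1%:M.
  by rewrite /rho -/q -CR !mulmxA RC mul1mx RC.
have qC : q *m C = C by rewrite -CR -mulmxA RC mulmx1.
have Rq : R *m q = R by rewrite -CR mulmxA RC mul1mx.
have rho_surj M : exists d, rho d = M.
  have [d dE] := Kcorner i0 i0 (C *m M *m R); exists d.
  rewrite /rho -dE -/q !mulmxA Rq RC mul1mx -(mulmxA _ q C) qC.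
  by rewrite -mulmxA RC mulmx1.
pose rhoL := linfun rho; have rhoLE d : rhoL d = rho d by apply: linfun_linear.
have ker0 : lker rhoL == 0%VS.
  by apply/lker0P => d d'; rewrite !rhoLE; apply: rho_inj.
pose theta := (rhoL^-1)%VF.
have thetaK d : theta (rho d) = d by rewrite -rhoLE lker0_lfunK.
have rhothK M : rho (theta M) = M.
  by have [d <-] := rho_surj M; rewrite thetaK.
have thetaM M M' : theta (M *m M') = theta M * theta M'.
  by apply: rho_inj; rewrite rhoM !rhothK.
have theta1 : theta 1%:M = 1 by apply: rho_inj; rewrite rhothK.
have K'_lin i j : linear (fun M : 'M[F]_l => K i j (theta M)).
  by move=> c M M'; rewrite linearP Klin.
pose K' i j : 'Hom('M[F]_l, 'M[F]_N) := linfun (fun M => K i j (theta M)).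
have K'E i j M : K' i j M = K i j (theta M) by apply: linfun_linear.
(* By [suppD] the components with nonzero second coordinate vanish, so nothing is lost in keeping
   the degrees [(g, 0)]. *)
pose D'_ g := (rhoL @: D_ (g, 0%R))%VS.
have D'P g M : (M \in D'_ g) = (theta M \in D_ (g, 0)).
  apply/memv_imgP/idP => [[d dg ->]|Mg]; first by rewrite rhoLE thetaK.
  by exists (theta M); rewrite // rhoLE rhothK.
exists l, D'_, K'; split.
- rewrite lt0n mxrank_eq0; apply: contraNneq (oner_neq0 D) => q0.
  apply/eqP; apply: (Kinj i0 i0); rewrite -/q q0.
  by have := linear0 (linfun (K i0 i0)); rewrite /= linfun_linear.
- split; last first.
    move=> g M; rewrite D'P => Mg M0.
    have [|y [xy yx]] := invD _ _ Mg.
      apply: contraNneq M0 => t0; rewrite -[M]rhothK t0.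
      by have := linear0 rhoL; rewrite /= rhoLE => ->.
    by exists (rho y); rewrite -{1 2}[M]rhothK -!rhoM xy yx rho1.
  split; last first.
    move=> g g' M M'; rewrite !D'P => Mg Mg'; rewrite thetaM.
    have -> : (g + g', 0) = (g, 0) + (g', 0) :> G * 'Z_2 by congr pair; rewrite addr0.
    exact: mulD.
  have [s [pr P]] := decomposition_proj decD.
  pose s1 := undup [seq gp.1 | gp <- s].
  pose pr' g : 'End('M[F]_l) := (rhoL \o pr (g, 0%R) \o theta)%VF.
  have pr'E g M : pr' g M = rho (pr (g, 0) (theta M)).
    by rewrite !comp_lfunE rhoLE.
  apply: (@proj_decomposition _ _ _ _ s1 pr'); split.
  + by move=> g M; rewrite D'P pr'E thetaK (projD P).
  + move=> g g' M; rewrite D'P pr'E => /(projE P (g, 0)) ->.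
    rewrite xpair_eqE eqxx andbT; case: ifP => _ //.
    by have := linear0 rhoL; rewrite /= rhoLE.
  + move=> M; under eq_bigr do rewrite pr'E -rhoLE.
    rewrite -linear_sum /= rhoLE -{1}[M]rhothK; congr rho.
    rewrite -(big_map (fun g => (g, 0)) xpredT (fun gp => pr gp (theta M))).
    apply: (proj_sum_supp P) => [|[g p] gp].
      by rewrite map_inj_uniq ?undup_uniq // => g g' [].
    have := projD P (g, p) (theta M).
    have [D0|/suppD /= /eqP p0] := eqVneq (D_ (g, p)) 0%VS.
      by rewrite D0 memv0 => /eqP.
    move=> _; apply: (proj_supp _ P); apply: contra gp => gps.
    apply/mapP; exists g; last by rewrite p0.
    by rewrite mem_undup; apply/mapP; exists (g, p).
- split=> [i j i' j' M M'|].
    by rewrite !K'E KM; case: ifP; rewrite ?thetaM.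
  by rewrite -K1; apply: eq_bigr => i _; rewrite K'E theta1.
- by move=> i j t M; rewrite D'P K'E; apply: Kdeg.
split=> [i j x|i].
  have [d dE] := Kcorner i j x; exists (rho d).
  by rewrite !K'E theta1 dE thetaK.
(* A factorization through [q] bounds the rank by that of [q], which is [l]. *)
have -> : K' i i 1%:M = K i i0 1 *m q *m K i0 i 1.
  by rewrite K'E theta1 /q !KM eqxx KM eqxx !mulr1.
exact: leq_trans (mxrankM_maxl _ _) (mxrankM_maxr _ _).
Qed.

(** * Parity of the matrix units *)

Lemma Z2_sub_eq0 (u v : 'Z_2) : (u - v == 0) = ((u == 0) == (v == 0)).
Proof. by case: u => [[|[|]]] // ?; case: v => [[|[|]]] // ?. Qed.

(** Commutation turns the odd equation into [q x + q x = x]; multiplying by [q] gives [q x = 0], in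
    every characteristic. *)
Lemma diag_offdiag0 (F : fieldType) (m n : nat) x :
  x \in diag_part F m n -> x \in offdiag_part F m n -> x = 0.
Proof.
rewrite mem_diag_part mem_offdiag_part => /eqP xd /eqP.
set q := parity_mx F m n in xd *; rewrite -xd => x2.
have qq : q *m q = q.
  by rewrite mulmx_block !(mulmx0, mul0mx, mulmx1, mul1mx, addr0).
have : q *m (q *m x + q *m x) = q *m x by rewrite x2.
rewrite mulmxDr mulmxA qq => /eqP; rewrite -subr_eq0 addrK => /eqP qx.
by rewrite -x2 qx addr0.
Qed.

Section UnitsParity.
Variables (F : fieldType) (m n l k : nat).
Variables (K : 'I_k -> 'I_k -> 'Hom('M[F]_l, 'M[F]_(m + n))) (p : 'I_k -> 'Z_2).
Hypothesis K_units : matrix_units K.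
Hypothesis K_corner :
  forall i j x, exists d, K i i 1%:M *m x *m K j j 1%:M = K i j d.
Hypothesis K_parity : forall i j d, K i j d \in super_part F m n (p i - p j).

(** Cut [x] into its corners: those with [p i = p j] are even and commute with [q], the others are
    odd and satisfy the odd equation for [q]. For [x] in one part the other half vanishes, so
    [parity_idempotent] applies to [q]. *)
Lemma even_units_parity : (0 < m)%N -> (0 < n)%N ->
  let q := \sum_(i | p i == 0) K i i 1%:M in
  q = parity_mx F m n \/ q = 1%:M - parity_mx F m n.
Proof.
move=> m_gt0 n_gt0 q; have [KM K1] := K_units.
have qK i j d : q *m K i j d = if p i == 0 then K i j d else 0.
  rewrite mulmx_suml; case: ifP => pi.
    rewrite (bigD1 i) //= KM eqxx mul1mx big1 ?addr0 // => i' /andP[_ /negPf i'i].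
    by rewrite KM i'i.
  by rewrite big1 // => i' pi'; rewrite KM; case: eqP => // ii'; rewrite -ii' pi' in pi.
have Kq i j d : K i j d *m q = if p j == 0 then K i j d else 0.
  rewrite mulmx_sumr; case: ifP => pj.
    rewrite (bigD1 j) //= KM eqxx mulmx1 big1 ?addr0 // => j' /andP[_ /negPf j'j].
    by rewrite KM eq_sym j'j.
  by rewrite big1 // => j' pj'; rewrite KM; case: eqP => // jj'; rewrite jj' pj' in pj.
have split_x x : exists2 yz : 'M[F]_(m + n) * 'M[F]_(m + n), x = yz.1 + yz.2 &
    [/\ yz.1 \in diag_part F m n, yz.2 \in offdiag_part F m n,
        q *m yz.1 = yz.1 *m q & q *m yz.2 + yz.2 *m q = yz.2].
  pose c i j := K i i 1%:M *m x *m K j j 1%:M.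
  have xE : x = \sum_i \sum_j c i j.
    rewrite -[x in LHS]mul1mx -[_ *m x]mulmx1 -K1 mulmx_suml mulmx_suml.
    by apply: eq_bigr => i _; rewrite mulmx_sumr.
  exists (\sum_i \sum_(j | p i - p j == 0) c i j,
          \sum_i \sum_(j | p i - p j != 0) c i j) => /=.
    rewrite -big_split {1}xE; apply: eq_bigr => i _ /=.
    by rewrite (bigID (fun j => p i - p j == 0)).
  split.
  - apply: memv_suml => i _; apply: memv_suml => j pij.
    have [d cE] := K_corner i j x; rewrite /c cE.
    by have := K_parity i j d; rewrite /super_part pij.
  - apply: memv_suml => i _; apply: memv_suml => j pij.
    have [d cE] := K_corner i j x; rewrite /c cE.
    by have := K_parity i j d; rewrite /super_part (negPf pij).
  - rewrite mulmx_sumr mulmx_suml; apply: eq_bigr => i _.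
    rewrite mulmx_sumr mulmx_suml; apply: eq_bigr => j.
    have [d cE] := K_corner i j x; rewrite /c cE qK Kq Z2_sub_eq0.
    by move/eqP->.
  - rewrite mulmx_sumr mulmx_suml -big_split; apply: eq_bigr => i _ /=.
    rewrite mulmx_sumr mulmx_suml -big_split; apply: eq_bigr => j /=.
    have [d cE] := K_corner i j x; rewrite /c cE qK Kq Z2_sub_eq0.
    by case: (p i == 0); case: (p j == 0); rewrite ?addr0 ?add0r.
apply: parity_idempotent => //.
- rewrite {2}/q mulmx_sumr; apply: eq_bigr => i pi; by rewrite qK pi.
- move=> x xd; have [[y z] /= xE [yd zo qy qz]] := split_x x.
  have z0 : z = 0.
    by apply: diag_offdiag0 zo; rewrite -[z](addKr y) -xE addrC memvB.
  by rewrite xE z0 addr0 qy.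
- move=> x xo; have [[y z] /= xE [yd zo qy qz]] := split_x x.
  have y0 : y = 0.
    by apply: (diag_offdiag0 yd); rewrite -[y](addrK z) -xE memvB.
  by rewrite xE y0 add0r qz.
Qed.

End UnitsParity.

Lemma rank_parity_mx (F : fieldType) (m n : nat) :
  \rank (parity_mx F m n) = m /\ \rank (1%:M - parity_mx F m n) = n.
Proof.
have -> : 1%:M - parity_mx F m n = block_mx 0 0 0 1%:M.
  by rewrite scalar_mx_block opp_block_mx add_block_mx !subr0 subrr.
by rewrite !rank_diag_block_mx !mxrank1 !mxrank0 addn0.
Qed.

(** * Sorting the units into two blocks *)

Section SortUnits.
Variables (F : closedFieldType) (G : zmodType) (m n l k : nat).
Variables (A_ : G -> {vspace 'M[F]_(m + n)}) (D_ : G -> {vspace 'M[F]_l}).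
Variables (K : 'I_k -> 'I_k -> 'Hom('M[F]_l, 'M[F]_(m + n))).
Variables (a : 'I_k -> G) (P : pred 'I_k).
Hypotheses (m_gt0 : (0 < m)%N) (l_gt0 : (0 < l)%N).
Hypotheses (decA : decomposition A_) (divD : division_grading (@mulmx F _ _ _) 1%:M D_).
Hypotheses (K_units : matrix_units K) (K_rank : forall i, (\rank (K i i 1%:M) <= l)%N).
Hypothesis K_degree : forall i j t d, d \in D_ t -> K i j d \in A_ (a i + t - a j).
Hypothesis K_parity : \sum_(i | P i) K i i 1%:M = parity_mx F m n.

Let s0 := enum P.
Let s1 := enum [predC P].
Let gamma0 := [seq a i | i <- s0].
Let gamma1 := [seq a i | i <- s1].

(** Subadditivity of rank gives [m <= size gamma0 * l] and [n <= size gamma1 * l], while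
    [k * l <= m + n]; hence both inequalities are equalities, as [Gamma] demands. *)
Lemma units_Gamma : exists (T : {fset G}) (beta : G -> G -> F)
    (e0 : (size gamma0 * l = m)%N) (e1 : (size gamma1 * l = n)%N),
  division_data T beta D_ /\ grading_iso (Gamma e0 e1 T D_) A_.
Proof.
have [T [beta dataD]] := division_grading_data divD l_gt0.
have [_ K1] := K_units.
have sz0 : size gamma0 = #|P| by rewrite size_map -cardE.
have sz1 : size gamma1 = #|[predC P]| by rewrite size_map -cardE.
have le_rank (Q : pred 'I_k) : (\rank (\sum_(i | Q i) K i i 1%:M)%R <= #|Q| * l)%N.
  rewrite -sum_nat_const.
  elim/big_ind2: _ => [|u x v y ux vy|i _]; first by rewrite mxrank0.
    exact: leq_trans (mxrank_add _ _) (leq_add ux vy).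
  exact: K_rank.
have [rkm rkn] := rank_parity_mx F m n.
have le0 : (m <= size gamma0 * l)%N by rewrite sz0 -{1}rkm -K_parity le_rank.
have le1 : (n <= size gamma1 * l)%N.
  rewrite sz1 -{1}rkn -K_parity -K1 (bigID P) /= [X in X - _]addrC addrK; exact: le_rank.
have kE : (size gamma0 + size gamma1 = k)%N.
  by rewrite sz0 sz1 cardC card_ord.
(* The map on matrix units embeds the matrices of size [k * l] in those of size [m + n]; compare
   dimensions. *)
have le_kl : (k * l <= m + n)%N.
  pose f := unit_map (erefl (k * l)%N) K.
  have f_inj : injective f by apply: unit_map_inj => //; rewrite addn_gt0 m_gt0.
  have ker0 : lker f == 0%VS by apply/lker0P.
  have : (\dim (f @: fullv) <= \dim {:'M[F]_(m + n)})%N by apply/dimvS/subvf.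
  rewrite limg_dim_eq ?(eqP ker0) ?capv0 // !dimvf !dim_matrix.
  move=> le2; rewrite -leq_sqr -!mulnn; exact: le2.
have [e0 e1] : (size gamma0 * l = m)%N /\ (size gamma1 * l = n)%N.
  move: le_kl; rewrite -kE mulnDl => le_kl; split; apply/eqP; rewrite eqn_leq.
    rewrite le0 andbT -(leq_add2r (size gamma1 * l)); apply: leq_trans le_kl _.
    by rewrite leq_add2l.
  rewrite le1 andbT -(leq_add2l (size gamma0 * l)); apply: leq_trans le_kl _.
  by rewrite leq_add2r.
exists T, beta, e0, e1; split=> //.
have [sT bT [_ _ DT _]] := dataD.
have szs : (size gamma0 + size gamma1)%N = size (s0 ++ s1).
  by rewrite size_cat !size_map.
have k_gt0 : (0 < k)%N.
  rewrite -kE addn_gt0; apply/orP; left; rewrite lt0n.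
  by apply: contraTneq m_gt0 => z0; rewrite -e0 z0.
pose i0 := Ordinal k_gt0.
pose sigma (x : nat) := nth i0 (s0 ++ s1) x.
have us : uniq (s0 ++ s1).
  rewrite cat_uniq !enum_uniq andbT /=; apply/hasPn => x.
  by rewrite !mem_enum.
have sigma_inj : injective (fun x : 'I_(size gamma0 + size gamma1) => sigma x).
  move=> x y /eqP; rewrite /sigma nth_uniq // -?szs ?ltn_ord //.
  by move/eqP/val_inj.
have sigma_bij : bijective (fun x : 'I_(size gamma0 + size gamma1) => sigma x).
  by apply: inj_card_bij sigma_inj _; rewrite !card_ord kE.
have gammaE (x : 'I_(size gamma0 + size gamma1)) : (gamma0 ++ gamma1)`_x = a (sigma x).
  by rewrite -map_cat (nth_map i0) // -szs.
apply: (Gamma_iso e0 e1 DT divD.1 (K := fun x y => K (sigma x) (sigma y))) => //.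
- by rewrite addn_gt0 m_gt0.
- split=> [x y x' y' d d'|].
    by rewrite (munitM K_units) (inj_eq sigma_inj).
  by rewrite -K1 [RHS](reindex _ (onW_bij _ sigma_bij)).
- by move=> x y t d dt; rewrite !gammaE K_degree.
left; transitivity (\sum_(i <- s0) K i i 1%:M); last by rewrite big_enum -K_parity.
rewrite (big_nth i0) -(size_map a s0) big_mkord; apply: eq_bigr => x _.
by rewrite /sigma /= nth_cat -(size_map a s0) ltn_ord.
Qed.

End SortUnits.

Lemma even_grading_Gamma (F : closedFieldType) (G : zmodType) (m n : nat)
    (A_ : G -> {vspace 'M[F]_(m + n)}) : (0 < m)%N -> (0 < n)%N -> even_grading A_ ->
  exists (T : {fset G}) (beta : G -> G -> F)
         (l : nat) (D_ : G -> {vspace 'M[F]_l}) (gamma0 gamma1 : seq G)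
         (e0 : (size gamma0 * l = m)%N) (e1 : (size gamma1 * l = n)%N),
    division_data T beta D_ /\ grading_iso A_ (Gamma e0 e1 T D_).
Proof.
move=> m_gt0 n_gt0 [[[decA _] _] [E [E_ [U [act [U_ [divE modU rkU isoU suppE]]]]]]].
have [k [h [K0 K0_units]]] := graded_units_of_module divE.1 modU rkU isoU.
have N_gt0 : (0 < m + n)%N by rewrite addn_gt0 m_gt0.
have [l [D_ [K [l_gt0 divD K_units Kdeg [Kcorner Krank]]]]] :=
  matrix_model N_gt0 divE suppE K0_units.
have [[decD _] _] := divD; have [s [pr P]] := decomposition_proj decD.
have K_degree i j t d : d \in D_ t -> K i j d \in A_ ((h i).1 + t - (h j).1).
  by move=> /(Kdeg i j); rewrite /sharp memv_cap => /andP[].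
have K_par i j d : K i j d \in super_part F m n ((h i).2 - (h j).2).
  rewrite [d](proj_sum P) linear_sum; apply: memv_suml => t _.
  have := Kdeg i j t _ (projD P t d).
  by rewrite /sharp memv_cap /= addr0 => /andP[].
have [K1 K2] := K_units.
(* The degrees [h] may have their parity opposite to that of the blocks; the indices of odd degree
   are then the ones that make up the first block. *)
have [Q KQ] : exists Q : pred 'I_k, \sum_(i | Q i) K i i 1%:M = parity_mx F m n.
  have := even_units_parity K_units Kcorner K_par m_gt0 n_gt0.
  case=> Kq; first by exists (fun i => (h i).2 == 0).
  exists (fun i => (h i).2 != 0); apply/eqP; rewrite -subr_eq0.
  rewrite -[parity_mx F m n](subKr 1%:M) -Kq -K2.
  rewrite [X in _ - (X - _)](bigID (fun i => (h i).2 == 0)) /=.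
  by rewrite [X in _ - (X - _)]addrC addrK subrr.
have [T [beta [e0 [e1 [dataD iso]]]]] :=
  units_Gamma m_gt0 l_gt0 decA divD K_units Krank K_degree KQ.
by exists T, beta, l, D_, _, _, e0, e1; split; [|apply: grading_iso_sym].
Qed.

Theorem theorem4p5 (F : closedFieldType) (G : zmodType) (m n : nat)
    (hm : (1 <= m)%N) (hn : (1 <= n)%N) :
  (forall A_ : G -> {vspace 'M[F]_(m + n)}, even_grading A_ ->
     exists (T : {fset G}) (beta : G -> G -> F)
            (l : nat) (D_ : G -> {vspace 'M[F]_l}) (gamma0 gamma1 : seq G)
            (e0 : (size gamma0 * l = m)%N) (e1 : (size gamma1 * l = n)%N),
       division_data T beta D_ /\ grading_iso A_ (Gamma e0 e1 T D_)) /\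
  (forall (T T' : {fset G}) (beta beta' : G -> G -> F)
          (l l' : nat) (D_ : G -> {vspace 'M[F]_l}) (D'_ : G -> {vspace 'M[F]_l'})
          (gamma0 gamma1 gamma0' gamma1' : seq G)
          (e0 : (size gamma0 * l = m)%N) (e1 : (size gamma1 * l = n)%N)
          (e0' : (size gamma0' * l' = m)%N) (e1' : (size gamma1' * l' = n)%N),
     division_data T beta D_ -> division_data T' beta' D'_ ->
     (grading_iso (Gamma e0 e1 T D_) (Gamma e0' e1' T' D'_) <->
      [/\ T = T',
          {in T &, forall u v, beta u v = beta' u v}
        & exists g : G,
            (m <> n ->
               act_mset g (Xi T gamma0) = Xi T' gamma0' /\
               act_mset g (Xi T gamma1) = Xi T' gamma1') /\
            (m = n ->
               (act_mset g (Xi T gamma0) = Xi T' gamma0' /\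
                act_mset g (Xi T gamma1) = Xi T' gamma1') \/
               (act_mset g (Xi T gamma0) = Xi T' gamma1' /\
                act_mset g (Xi T gamma1) = Xi T' gamma0'))])).
Proof.
have N_gt0 : (0 < m + n)%N by rewrite addn_gt0 hm.
split=> [A_|T T' beta beta' l l' D_ D'_ gamma0 gamma1 gamma0' gamma1' e0 e1 e0' e1'].
  exact: even_grading_Gamma.
move=> dataD dataD'.
(* [D_] and [D'_] live in matrix algebras of a priori different sizes, but both squares are the
   order of the support. *)
have eq_size : T = T' -> l = l'.
  have [_ _ [cT _ _ _]] := dataD; have [_ _ [cT' _ _ _]] := dataD'.
  by move=> TT'; apply/eqP; rewrite -eqn_sqr cT cT' TT'.
split=> [iso|[TT' bb' [g [gne geq]]]].
  have [phi [phi_auto phiG]] := iso.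
  have [phi' [phi'_auto phi'G]] := grading_iso_sym iso.
  have [TT' bb'] := Gamma_iso_support dataD dataD' phi_auto phiG N_gt0.
  have [T'T _] := Gamma_iso_support dataD' dataD phi'_auto phi'G N_gt0.
  have eqT : T = T' by apply/fsetP => t; apply/idP/idP; [apply: TT'|apply: T'T].
  move: (eq_size eqT) => ell; clear phi phi_auto phiG phi' phi'_auto phi'G.
  subst l' T'; split=> //.
  have [g gXi] := Xi_of_Gamma_iso dataD dataD' hm hn iso.
  (* The swapped alternative would give [size gamma0 = size gamma1'], hence [m = n] after
     multiplication by [l]. *)
  exists g; split=> // mn; case: gXi => // -[/act_mset_XiP/perm_size gXi _].
  by case: mn; rewrite -e0 -e1'; move: gXi; rewrite !size_map => ->.
move: (eq_size TT') => ell; subst l' T'.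
have [mn|/eqP mn] := eqVneq m n.
  case: (geq mn) => -[].
    exact: (Gamma_iso_of_Xi e0 e1 e0' e1' dataD dataD' bb' N_gt0).
  exact: (Gamma_iso_of_Xi_swap e0 e1 e0' e1' dataD dataD' bb' N_gt0).
by have [] := gne mn; apply: (Gamma_iso_of_Xi e0 e1 e0' e1' dataD dataD' bb' N_gt0).
Qed.
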